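(* Let $p$ be a prime, $q=p^e$, $m,k\ge1$, and let $D\subseteq[0,k(q^m-1)]$ with $D\ne\{0\}$. Let $\mathcal{T}_D=\{\boldsymbol{t}=(t_1,\dots,t_k)\in[0,q^m-1]^k:|\boldsymbol{t}|\in D\}$. Let $f\in\mathbb{F}_{q^m}[x_1,\dots,x_k]$ be a polynomial with $\mathrm{Deg}(f)\subseteq D$. Then $\nu_p\big(N(f=y^q-y)\big)$ is at least the minimum of $\frac{1}{p-1}\sum_{\boldsymbol{t}\in\mathcal{T}_D}S_p(r_{\boldsymbol{t}})$ over all $\boldsymbol{r}=(r_{\boldsymbol{t}})_{\boldsymbol{t}\in\mathcal{T}_D}\in[0,q^m-1]^{\mathcal{T}_D}$ such that $\sum_{\boldsymbol{t}\in\mathcal{T}_D}r_{\boldsymbol{t}}\equiv0\pmod{q-1}$ and, for each $1\le i\le k$, $\sum_{\boldsymbol{t}\in\mathcal{T}_D}r_{\boldsymbol{t}}t_i$ is a positive multiple of $q^m-1$. Moreover, there exists a polynomial $f$ with $\mathrm{Deg}(f)\subseteq D$ for which $\nu_p(N(f=y^q-y))$ equals this minimum.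
   Context: $N(f=y^q-y)$ denotes the number of $(x_1,\dots,x_k,y)\in\mathbb{F}_{q^m}^{k+1}$ with $f(x_1,\dots,x_k)=y^q-y$. If $f=f_{d_1}+\cdots+f_{d_t}$ with $f_{d_i}$ the nonzero homogeneous component of degree $d_i$, then $\mathrm{Deg}(f)=\{d_1,\dots,d_t\}$. $|\boldsymbol{t}|=t_1+\cdots+t_k$; $[a,b]=\{i\in\mathbb{Z}:a\le i\le b\}$. $S_p(a)$ is the sum of base-$p$ digits of $a$; $\nu_p$ is the $p$-adic valuation. *)

(* Defs.v *)
From HB Require Import structures.
From mathcomp Require Import all_boot all_order all_algebra all_field.
From mathcomp Require Import mpoly.



Unset Printing Implicit Defensive.

Import Order.TTheory GRing.Theory Num.Theory.

(* S_p(a): sum of the base-p digits of a.  The i-th digit is (a %/ p^i) %% p;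
   for p >= 2 all digits of index > a vanish, so summing i = 0..a suffices. *)
Definition digsum (p a : nat) : nat := \sum_(i < a.+1) ((a %/ p ^ i) %% p).

Definition hcomp {n : nat} {R : nzRingType} (d : nat) (f : {mpoly R[n]}) : {mpoly R[n]} :=
  (\sum_(mon <- msupp f | mdeg mon == d) f@_mon *: 'X_[mon])%R.

Definition Deg {n : nat} {R : nzRingType} (f : {mpoly R[n]}) : pred nat :=
  fun d => hcomp d f != 0%R.

Definition Ncount {k : nat} {F : finFieldType} (q : nat) (f : {mpoly F[k]}) : nat :=
  #|[set xy : {ffun 'I_k -> F} * F | (f.@[xy.1] == xy.2 ^+ q - xy.2)%R]|.

Definition inTD {k Q : nat} (D : pred nat) (t : {ffun 'I_k -> 'I_Q}) : bool :=
  D (\sum_(i < k) (t i : nat)).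

(* r = (r_t)_{t in T_D} in [0, Q-1]^{T_D} (values outside T_D are irrelevant),
   with sum r_t = 0 mod (q-1), and for every i, sum r_t t_i a positive
   multiple of Q - 1. *)
Definition feasible (q Q k : nat) (D : pred nat) (r : {ffun 'I_k -> 'I_Q} -> nat) : Prop :=
  [/\ (forall t, inTD D t -> r t <= Q - 1),
      (q - 1 %| \sum_(t | inTD D t) r t)
    & (forall i : 'I_k,
         0 < \sum_(t | inTD D t) r t * t i /\ (Q - 1 %| \sum_(t | inTD D t) r t * t i))].

Definition objective (p Q k : nat) (D : pred nat) (r : {ffun 'I_k -> 'I_Q} -> nat) : rat :=
  ((\sum_(t | inTD D t) digsum p (r t))%:R / (p - 1)%:R)%R.

Definition is_min_value (p q Q k : nat) (D : pred nat) (mu : rat) : Prop :=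
  (exists r, feasible q Q k D r /\ objective p Q k D r = mu) /\
  (forall r, feasible q Q k D r -> (mu <= objective p Q k D r)%R).

(* Main.v *)
(* Fix a nontrivial additive character psi of F.  Stickelberger's theorem gives
   psi(a) = sum_(r < #|F|) c_r tau(a)^r, with tau the Teichmueller character and
   c_r of valuation exactly S_p(r) / (p - 1).  Expanding
   N = sum_x sum_(c in F_q) psi(c f(x)) monomial by monomial, only the exponent
   vectors r satisfying the congruences of the theorem survive, with
   valuation sum_t S_p(r_t) / (p - 1) plus a factor #|F| for each coordinate
   whose exponent sum vanishes; this gives the lower bound.  The monomials of f
   may have exponents above #|F| - 1, so each such r has to be moved to T_D
   without increasing its cost (lemma box_reduction).  For equality, the leading
   coefficient of N is, as a function of the coefficients of f, a nonzero
   polynomial of degree < #|F| in each of them, hence not identically 0.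
   All valuations are taken in a finite quotient of the ring of integers of
   Q_p(zeta_p, zeta_(#|F| - 1)), obtained from Z/p^M by adjoining a root of
   ((1 + Y)^p - 1) / Y and then a lift of a generator of F. *)

Require Import Defs.
From HB Require Import structures.
From mathcomp Require Import all_boot all_order all_fingroup all_solvable all_algebra all_field.
From mathcomp Require Import mpoly zify ring.

Import Order.TTheory GRing.Theory Num.Theory.

(** The finite quotient is not a domain, and this shapes the arguments. Valuations are relations,
    meaningful only below the nilpotency index [L], and only elements of nonzero residue can be
    cancelled. In particular a sum of character values cannot be shown to vanish by dividing by
    zeta_p - 1, which is nilpotent; fibres are counted instead. Stickelberger's theorem is likewise
    obtained from upper bounds on valuations of Gauss sums, by dividing products, and from one exact
    product formula. The exponents of f cannot simply be reduced modulo x^#|F| - x, since this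
    changes the total degree and may leave D. What must survive is the sum of each row of the
    exponent matrix (the degree of a monomial), and, for each coordinate, positivity of the weighted
    column sum and its divisibility by #|F| - 1. The reduction therefore moves multiples of #|F| - 1
    inside a row and merges columns. A vanishing count has infinite valuation, whence the separate
    alternative in the lower bound. *)

Set Implicit Arguments.
Unset Strict Implicit.

(** * Adjoining a root of a monic polynomial to a ring *)

Section QpolyEval.
Local Open Scope ring_scope.
Variables (B S : comNzRingType) (rho : {rmorphism B -> S}) (h : {poly B}) (x : S).

Definition qpoly_eval (_ : root (map_poly rho (mk_monic h)) x) (o : {poly %/ h}) : S :=
  (map_poly rho (o : {poly B})).[x].

Hypothesis hx : root (map_poly rho (mk_monic h)) x.

Lemma qpoly_eval_in (b : {poly B}) :
  qpoly_eval hx (in_qpoly h b) = (map_poly rho b).[x].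
Proof.
have mh := monic_mk_monic h.
rewrite {2}(Pdiv.RingMonic.rdivp_eq mh b) /qpoly_eval /= rmorphD rmorphM /=.
by rewrite hornerD hornerM (rootP hx) mulr0 add0r.
Qed.

Lemma qpoly_eval_zmod : zmod_morphism (qpoly_eval hx).
Proof. by move=> u v; rewrite /qpoly_eval !raddfB /= hornerD hornerN. Qed.

Lemma qpoly_eval_monoid : monoid_morphism (qpoly_eval hx).
Proof.
split=> [|u v]; first by rewrite /qpoly_eval /= rmorph1 hornerE.
by rewrite [u * v]/(in_qpoly h _) qpoly_eval_in rmorphM /= hornerM.
Qed.

HB.instance Definition _ :=
  GRing.isZmodMorphism.Build {poly %/ h} S (qpoly_eval hx) qpoly_eval_zmod.
HB.instance Definition _ :=
  GRing.isMonoidMorphism.Build {poly %/ h} S (qpoly_eval hx) qpoly_eval_monoid.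

End QpolyEval.

Lemma in_qpolyC (B : comNzRingType) (h : {poly B}) (b : B) :
  in_qpoly h b%:P%R = qpolyC h b.
Proof.
apply/val_inj/in_qpoly_small; rewrite size_polyC.
by rewrite (leq_ltn_trans _ (size_mk_monic_gt1 h)) //; case: eqP.
Qed.

Lemma map_qpolyC_horner (B : comNzRingType) (h b : {poly B}) :
  ((map_poly (qpolyC h) b).['qX] = in_qpoly h b)%R.
Proof.
rewrite -{2}[b]coefK poly_def rmorph_sum /=.
rewrite (@horner_coef_wide _ (size b)) ?size_poly //.
apply: eq_bigr => i _.
by rewrite coef_map /= -mul_polyC rmorphM rmorphXn /= in_qpolyC.
Qed.

(** The ring is B[X]/(h). The conclusion records what both later adjunctions use: an extension of
    the residue map, and freeness over B on the powers of X below the degree of h. *)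
Lemma simple_ring_extension (B S : comNzRingType) (rho : {rmorphism B -> S})
    (h : {poly B}) (x : S) :
    h \is monic -> 1 < size h -> root (map_poly rho h) x ->
  exists (O : comNzRingType) (iota : {rmorphism B -> O}) (rhoO : {rmorphism O -> S}) (X : O),
  [/\ forall b, rhoO (iota b) = rho b, rhoO X = x, (map_poly iota h).[X]%R = 0%R,
      forall o, exists2 b : {poly B}, size b < size h & o = (map_poly iota b).[X]%R
    & forall b : {poly B}, size b < size h -> (map_poly iota b).[X]%R = 0%R -> b = 0%R].
Proof.
move=> mh sh hx.
have hh : mk_monic h = h by rewrite /mk_monic sh mh.
have hx' : root (map_poly rho (mk_monic h)) x by rewrite hh.
exists ({poly %/ h} : comNzRingType), (qpolyC h : {rmorphism _ -> _}).
exists (qpoly_eval hx' : {rmorphism _ -> _}), 'qX%R; split.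
- by move=> b; rewrite /= -in_qpolyC qpoly_eval_in map_polyC hornerC.
- by rewrite /= qpoly_eval_in map_polyX hornerX.
- rewrite map_qpolyC_horner; apply: val_inj => /=.
  by rewrite hh Pdiv.RingMonic.rmodpp.
- move=> o; exists (o : {poly B}); first by rewrite -{2}hh size_mk_monic.
  rewrite map_qpolyC_horner; apply: val_inj => /=.
  by rewrite Pdiv.CommonRing.rmodp_small // size_mk_monic.
move=> b sb; rewrite map_qpolyC_horner => /(congr1 (fun o : {poly %/ h} => o : {poly B})).
by rewrite /= Pdiv.CommonRing.rmodp_small // hh.
Qed.

(** * The prime field inside a finite field *)

Section FiniteField.
Local Open Scope ring_scope.
Variables (p : nat) (F : finFieldType).
Hypothesis charFp : p \in [pchar F].

Let p_pr : prime p := pcharf_prime charFp.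

Lemma finField_generator : exists2 g : F, g != 0 & forall a, a != 0 -> exists k, a = g ^+ k.
Proof.
have /cyclicP[x Dx] := field_unit_group_cyclic [set: {unit F}]%G.
exists (val x); first by have := valP x; rewrite unitfE.
move=> a a0; have Ua : a \is a GRing.unit by rewrite unitfE.
have : FinRing.unit F Ua \in <[x]>%g by rewrite -Dx inE.
by case/cycleP=> k /(congr1 val); rewrite FinRing.val_unitX => /= ->; exists k.
Qed.

Lemma expfD_pchar (a b : F) n : (a + b) ^+ (p ^ n) = a ^+ (p ^ n) + b ^+ (p ^ n).
Proof.
apply: exprDn_pchar; rewrite pnatX; apply/orP; left.
by rewrite (eq_pnat _ (pcharf_eq charFp)) pnat_id.
Qed.

Lemma expf_natr_pchar n : (n%:R : F) ^+ p = n%:R.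
Proof. by rewrite -(pFrobenius_autE charFp) pFrobenius_aut_nat. Qed.

(** X^p - X has at most p roots, and the images of 0, ..., p - 1 already are p of them. *)
Lemma prime_subfieldP (a : F) : a ^+ p = a -> exists2 n, (n < p)%N & a = n%:R.
Proof.
move=> ap; pose P : {poly F} := 'X^p - 'X.
pose rs := [seq i%:R : F | i <- iota 0 p].
have sP : size P = p.+1.
  by rewrite size_polyDl size_polyXn // size_polyN size_polyX ltnS prime_gt1.
have P0 : P != 0 by rewrite -size_poly_eq0 sP.
have urs : uniq rs.
  rewrite map_inj_in_uniq ?iota_uniq // => i j; rewrite !mem_iota !add0n /=.
  wlog le_ij : i j / (i <= j)%N => [W|] ilt jlt eij.
    by case/orP: (leq_total i j) => le; [exact: W | apply/esym/W].
  have : (p %| j - i)%N by rewrite (dvdn_pcharf charFp) natrB // eij subrr.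
  by move=> /dvdn_leq le; have [|/le] := posnP (j - i)%N; lia.
have [ars|nars] := boolP (a \in rs).
  by case/mapP: ars => i; rewrite mem_iota => /andP[_ ilt] ->; exists i.
have /(max_poly_roots P0) : all (root P) (a :: rs).
  apply/allP=> b; rewrite inE /root !hornerE => /orP[/eqP->|/mapP[i _ ->]].
    by rewrite ap subrr.
  by rewrite expf_natr_pchar subrr.
by rewrite /= nars urs sP /= size_map size_iota ltnS ltnn => /(_ isT).
Qed.

End FiniteField.

(** * The truncated cyclotomic ring *)

Lemma add1_nilpotent_unit (O : comNzRingType) (z : O) n :
  (z ^+ n = 0 -> exists v, (1 + z) * v = 1)%R.
Proof.
move=> zn; exists (\sum_(i < n) 1 ^+ (n.-1 - i) * (- z) ^+ i)%R.
by rewrite -{1}[z]opprK -subrXX expr1n exprNn zn mulr0 subr0.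
Qed.

Section ZpReduce.
Local Open Scope ring_scope.
Variables (n : nat) (S : comNzRingType).

Definition Zp_reduce (_ : (1 < n)%N) (_ : n%:R = 0 :> S) (z : 'Z_n) : S := (z : nat)%:R.

Hypotheses (n1 : (1 < n)%N) (nS : n%:R = 0 :> S).

Lemma Zp_reduce_natr m : Zp_reduce n1 nS m%:R = m%:R.
Proof.
rewrite /Zp_reduce val_Zp_nat // [in RHS](divn_eq m n) natrD natrM nS.
by rewrite mulr0 add0r.
Qed.

Lemma Zp_reduce_zmod : zmod_morphism (Zp_reduce n1 nS).
Proof.
suff D u v : Zp_reduce n1 nS (u + v) = Zp_reduce n1 nS u + Zp_reduce n1 nS v.
  by move=> u v; apply: (addIr (Zp_reduce n1 nS v)); rewrite -D !subrK.
by rewrite -{1}[u]natr_Zp -{1}[v]natr_Zp -natrD Zp_reduce_natr natrD.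
Qed.

Lemma Zp_reduce_monoid : monoid_morphism (Zp_reduce n1 nS).
Proof.
split=> [|u v]; first by rewrite -[1]/(1%:R) Zp_reduce_natr.
by rewrite -{1}[u]natr_Zp -{1}[v]natr_Zp -natrM Zp_reduce_natr natrM.
Qed.

HB.instance Definition _ :=
  GRing.isZmodMorphism.Build 'Z_n S (Zp_reduce n1 nS) Zp_reduce_zmod.
HB.instance Definition _ :=
  GRing.isMonoidMorphism.Build 'Z_n S (Zp_reduce n1 nS) Zp_reduce_monoid.

End ZpReduce.

(** Both sides are ((1 + x)^n - 1) / x, written without division. *)
Lemma sum_exp1D (R : comNzRingType) (x : R) n :
  (\sum_(i < n) (1 + x) ^+ i = \sum_(k < n) 'C(n, k.+1)%:R * x ^+ k)%R.
Proof.
elim: n => [|n IH]; first by rewrite !big_ord0.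
under [RHS]eq_bigr => k _ do rewrite binS natrD mulrDl.
rewrite big_split big_ord_recr /= IH; congr (_ + _)%R.
  by rewrite big_ord_recr /= bin_small // mul0r addr0.
rewrite exprDn; apply: eq_bigr => i _.
by rewrite expr1n mul1r mulr_natl.
Qed.

(** The adjoined polynomial [h] is of Eisenstein type: monic, with constant term p and inner
    coefficients divisible by p. Hence [h] at pi reads p (1 + pi w) = - pi^(p - 1), where 1 + pi w
    is a unit by nilpotency. Up to a unit, [pi ^+ L.-1] is then p^(M - 1) pi^(p - 2), which is
    nonzero because the ring is free over [Z] on 1, ..., pi^(p - 2). *)
Lemma cyclotomic_extension (p M : nat) (Z F : comNzRingType) (rho0 : {rmorphism Z -> F}) :
    prime p -> 0 < M -> (p%:R = 0 :> F)%R -> ((p ^ M)%:R = 0 :> Z)%R ->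
    ((p ^ M.-1)%:R <> 0 :> Z)%R -> (forall z : Z, exists n : nat, z = n%:R%R) ->
  exists (B : comNzRingType) (rho : {rmorphism B -> F}) (pi : B), let L := M * (p - 1) in
  [/\ forall b, exists2 n : nat, rho b = n%:R%R & p %| n -> exists y, b = (pi * y)%R,
      rho pi = 0%R, (pi ^+ L = 0)%R /\ (pi ^+ L.-1 <> 0)%R,
      (\sum_(i < p) (1 + pi) ^+ i = 0)%R
    & exists2 u : B, rho u = (-1)%R & (p%:R = pi ^+ (p - 1) * u)%R].
Proof.
case: p => [|[|r]] // p_pr; set p := r.+2 in p_pr *.
rewrite subn1 -[p.-1]/(r.+1) => M0 pF pMZ pMZ' natZ.
pose h : {poly Z} := (\poly_(k < p) 'C(p, k.+1)%:R)%R.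
have lh : ('C(p, p.-1.+1)%:R != 0 :> Z)%R by rewrite binn oner_neq0.
have sh : size h = p by rewrite size_poly_eq.
have mh : h \is monic by rewrite monicE lead_coefE sh coef_poly leqnn binn.
have hx : root (map_poly rho0 h) 0%R.
  by rewrite /root horner_coef0 coef_map coef_poly bin1 /= rmorph_nat pF.
have sh1 : 1 < size h by rewrite sh.
have [B [iota [rho [pi [rhoi rhopi hpi spanB freeB]]]]] := simple_ring_extension mh sh1 hx.
have evalE (c : {poly Z}) : size c <= p -> ((map_poly iota c).[pi] = \sum_(i < p) iota c`_i * pi ^+ i)%R.
  move=> sc; rewrite (@horner_coef_wide _ p); last by rewrite (leq_trans (size_poly _ _)).
  by apply: eq_bigr => i _; rewrite coef_map.
exists B, rho, pi => L.
have sum0 : (\sum_(i < p) (1 + pi) ^+ i = 0)%R.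
  rewrite sum_exp1D -[RHS]hpi evalE ?sh //.
  by apply: eq_bigr => i _; rewrite coef_poly ltn_ord rmorph_nat.
have [w pw] : exists w, (p%:R * (1 + pi * w) = - pi ^+ r.+1)%R.
  exists (\sum_(i < r) ('C(p, i.+2) %/ p)%:R * pi ^+ i)%R.
  move: sum0; rewrite sum_exp1D big_ord_recl big_ord_recr /= bin1 binn mul1r.
  rewrite addrA => /eqP; rewrite addr_eq0 => /eqP <-.
  rewrite mulrDr !mulr1; congr (_ + _)%R.
  rewrite !mulr_sumr; apply: eq_bigr => i _.
  have /divnK Dc : p %| 'C(p, i.+2) by rewrite prime_dvd_bin // /p; have := ltn_ord i; lia.
  by rewrite -[in RHS]Dc natrM exprS; ring.
have pM : (p%:R ^+ M = 0 :> B)%R by rewrite -natrX -(rmorph_nat iota) pMZ rmorph0.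
have piL : (pi ^+ L = 0)%R.
  by rewrite /L mulnC exprM -[(pi ^+ r.+1)%R]opprK -pw exprNn exprMn pM mul0r mulr0.
have [v vw] : exists v, ((1 + pi * w) * v = 1)%R.
  by apply: (@add1_nilpotent_unit _ _ L); rewrite exprMn piL mul0r.
have pu : (p%:R = pi ^+ r.+1 * - v)%R by rewrite mulrN -mulNr -pw -mulrA vw mulr1.
have rhov : rho v = 1%R.
  have := congr1 rho vw.
  by rewrite rmorphM rmorphD !rmorph1 rmorphM /= rhopi mul0r addr0 mul1r.
split=> //; last by exists (- v)%R; rewrite // rmorphN rhov.
- move=> b; have [c sc ->] := spanB b; rewrite sh in sc.
  have [n c0] := natZ (c`_0)%R.
  rewrite evalE 1?ltnW // big_ord_recl /= expr0 mulr1 c0 rmorph_nat.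
  exists n.
    rewrite rmorphD /= rmorph_nat rmorph_sum /= big1 ?addr0 // => i _.
    by rewrite rmorphM rmorphXn /= rhopi expr0n mulr0.
  move=> /dvdnP[m ->].
  exists (pi ^+ r * - v * m%:R + \sum_(i < r.+1) iota c`_i.+1 * pi ^+ i)%R.
  rewrite (natrM _ m p) pu exprS mulrDr mulr_sumr; congr (_ + _)%R; first by ring.
  by apply: eq_bigr => i _; rewrite exprS mulrCA.
split=> // pi0.
have L1 : L.-1 = r.+1 * M.-1 + r by rewrite /L; case: (M) M0 => // m _; rewrite /=; lia.
apply: pMZ'.
have : (map_poly iota ((p ^ M.-1)%:R *: 'X^r)).[pi]%R = 0%R.
  rewrite map_polyZ map_polyXn hornerZ hornerXn /= rmorph_nat natrX pu exprMn -exprM.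
  by rewrite mulrAC -exprD -L1 pi0 mul0r.
move=> /freeB c0; have /c0 : size ((p ^ M.-1)%:R *: 'X^r : {poly Z})%R < size h.
  by rewrite (leq_ltn_trans (size_scale_leq _ _)) // size_polyXn sh.
by move/polyP/(_ r); rewrite coefZ coefXn eqxx mulr1 coef0.
Qed.

(* The ring is Z[zeta_p]/(p^M), and [pi] is [zeta_p - 1]. *)
Lemma truncated_cyclotomic_ring (p M : nat) (F : comNzRingType) :
    prime p -> 0 < M -> (p%:R = 0 :> F)%R ->
  exists (B : comNzRingType) (rho : {rmorphism B -> F}) (pi : B), let L := M * (p - 1) in
  [/\ forall b, exists2 n : nat, rho b = n%:R%R & p %| n -> exists y, b = (pi * y)%R,
      rho pi = 0%R, (pi ^+ L = 0)%R /\ (pi ^+ L.-1 <> 0)%R,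
      (\sum_(i < p) (1 + pi) ^+ i = 0)%R
    & exists2 u : B, rho u = (-1)%R & (p%:R = pi ^+ (p - 1) * u)%R].
Proof.
move=> p_pr M0 pF; have p1 := prime_gt1 p_pr.
have n1 : 1 < p ^ M by rewrite -(expn0 p) ltn_exp2l.
have nF : ((p ^ M)%:R = 0 :> F)%R by rewrite natrX pF expr0n; case: (M) M0.
apply: (cyclotomic_extension (Zp_reduce n1 nF : {rmorphism _ -> _})) => //.
- by rewrite pchar_Zp.
- move/(congr1 (fun z : 'Z_(p ^ M) => z : nat)); rewrite val_Zp_nat // modn_small ?ltn_exp2l //.
    by move/eqP; rewrite expn_eq0; lia.
  by lia.
by move=> z; exists (z : nat); rewrite natr_Zp.
Qed.

(** * Extension of the residue field to F, and Teichmueller lifts *)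

Section StickelbergerRing.
Local Open Scope ring_scope.
Variables (p : nat) (F : finFieldType).
Hypothesis charFp : p \in [pchar F].

Lemma prime_subfield_div (a b : F) : a ^+ p = a -> b ^+ p = b -> (a / b) ^+ p = a / b.
Proof. by move=> ha hb; rewrite exprMn exprVn ha hb. Qed.

(** This is the minimal polynomial of g over the prime field, whose elements are encoded as the
    solutions of a^p = a. Some relation exists because g^(#|F| - 1) = 1. For the minimal n the lower
    powers are independent: a dependence with leading index j < n, divided by its leading
    coefficient, would be a monic relation of degree j. *)
Lemma minimal_monic_relation (g : F) : g != 0 ->
  exists n (c : 'I_n -> F), [/\ (0 < n)%N, forall i, c i ^+ p = c i,
    g ^+ n = \sum_(i < n) c i * g ^+ i
  & forall d : nat -> F, (forall i, d i ^+ p = d i) ->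
      \sum_(i < n) d i * g ^+ i = 0 -> forall i, (i < n)%N -> d i = 0].
Proof.
move=> g0; have p_pr := pcharf_prime charFp; have p0 := prime_gt0 p_pr.
pose P n := [exists c : {ffun 'I_n -> F},
  [forall i, c i ^+ p == c i] && (g ^+ n == \sum_(i < n) c i * g ^+ i)].
have exP : exists n, P n.
  exists #|F|.-1; apply/existsP; exists [ffun i : 'I__ => (i == 0%N :> nat)%:R].
  have F1 : (0 < #|F|.-1)%N by have := finNzRing_gt1 F; case: #|F| => [|[]].
  apply/andP; split; first by apply/forallP=> i; rewrite ffunE expf_natr_pchar.
  have gF : g ^+ #|F|.-1 = 1.
    apply: (mulfI g0); rewrite -exprS mulr1 prednK ?expf_card //.
    by have := finNzRing_gt1 F; lia.
  rewrite gF (bigD1 (Ordinal F1)) //= ffunE mul1r expr0 big1 ?addr0 //.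
  by move=> i /negPf; rewrite -val_eqE /= ffunE => ->; rewrite mul0r.
have [n] := ex_minnP exP => /existsP[c /andP[/forallP cp /eqP gn]] nmin.
exists n, c; split=> //.
- case: n c gn {cp nmin} => // c; rewrite big_ord0 expr0 => /eqP.
  by rewrite oner_eq0.
- by move=> i; apply/eqP.
move=> d dp.
suff H j : (j <= n)%N -> \sum_(i < j) d i * g ^+ i = 0 -> forall i, (i < j)%N -> d i = 0.
  exact: H.
elim: j => // j IH jn.
rewrite big_ord_recr /= => dj0.
have dj : d j = 0.
  apply/eqP; apply: contraLR jn => dj; rewrite -leqNgt; apply: nmin.
  apply/existsP; exists [ffun i : 'I_j => - d i / d j]; apply/andP; split.
    apply/forallP=> i; rewrite ffunE prime_subfield_div //.
    by rewrite -(pFrobenius_autE charFp) pFrobenius_autN pFrobenius_autE dp.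
  apply/eqP; move/eqP: dj0; rewrite addrC addr_eq0 => /eqP dj0.
  apply: (mulfI dj); rewrite dj0 -sumrN mulr_sumr; apply: eq_bigr => i _.
  by rewrite ffunE; field.
move: dj0; rewrite dj mul0r addr0 => /(IH (ltnW jn)) d0 i.
by rewrite ltnS leq_eqVlt => /orP[/eqP->|/d0].
Qed.

(** The minimal polynomial of a generator g is lifted through integer representatives of its
    coefficients. Independence of the powers of g over the prime field shows that an element of
    residue 0 has all its coordinates in pi B, so pi generates the kernel; the powers of g make the
    residue map onto. *)
Lemma stickelberger_ring (M : nat) : (0 < M)%N ->
  exists (O : comNzRingType) (rho : {rmorphism O -> F}) (pi : O), let L := (M * (p - 1))%N in
  [/\ forall a, exists o, rho o = a,
      forall o, rho o = 0 <-> exists y, o = pi * y,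
      pi ^+ L = 0 /\ (forall n u, rho u != 0 -> pi ^+ n * u = 0 -> (L <= n)%N),
      \sum_(i < p) (1 + pi) ^+ i = 0
    & exists2 u, rho u != 0 & p%:R = pi ^+ (p - 1) * u].
Proof.
move=> M0; have p_pr := pcharf_prime charFp; have p0 := prime_gt0 p_pr.
have [B [rhoB [pi [natB rhopi [piL piL'] sumpi [u rhou pu]]]]] :=
  truncated_cyclotomic_ring p_pr M0 (pcharf0 charFp).
have [g g0 gen] := finField_generator F.
have [n [c [n0 cp gn gfree]]] := minimal_monic_relation g0.
have [m mc] : exists m : 'I_n -> nat, forall i, c i = (m i)%:R.
  apply: (@fin_all_exists _ (fun=> nat) (fun i k => c i = k%:R)) => i.
  by have [k _ ->] := prime_subfieldP charFp (cp i); exists k.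
pose q : {poly B} := \poly_(i < n) (if insub i is Some j then (m j)%:R else 0).
have sq : (size q <= n)%N by rewrite size_poly.
pose h : {poly B} := 'X^n - q.
have sh : size h = n.+1 by rewrite size_polyDl size_polyXn // size_polyN ltnS.
have mh : h \is monic.
  by rewrite monicE lead_coefE sh coefB coefXn eqxx nth_default // subr0.
have hx : root (map_poly rhoB h) g.
  rewrite /root rmorphB /= map_polyXn hornerD hornerN hornerXn gn.
  rewrite (@horner_coef_wide _ n) ?(leq_trans (size_poly _ _)) // subr_eq0.
  apply/eqP/eq_bigr => i _; rewrite coef_map coef_poly ltn_ord valK /=.
  by rewrite rmorph_nat mc.
have sh1 : (1 < size h)%N by rewrite sh.
have [O [iota [rho [X [rhoi rhoX _ spanO freeO]]]]] := simple_ring_extension mh sh1 hx.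
exists O, rho, (iota pi) => L.
have surj a : exists o, rho o = a.
  have [->|/gen[k ->]] := eqVneq a 0; first by exists 0; rewrite rmorph0.
  by exists (X ^+ k); rewrite rmorphXn /= rhoX.
have rhopi0 : rho (iota pi) = 0 by rewrite rhoi.
have iota0 b : iota b = 0 -> b = 0.
  move=> b0; have /freeO : (size b%:P < size h)%N.
    by rewrite sh ltnS (leq_trans (size_polyC_leq1 _)).
  by rewrite map_polyC hornerC => /(_ b0)/eqP; rewrite polyC_eq0 => /eqP.
have piL0 : iota pi ^+ L = 0 by rewrite -rmorphXn piL rmorph0.
have ker o : rho o = 0 <-> exists y, o = iota pi * y.
  split=> [|[y ->]]; last by rewrite rmorphM /= rhopi0 mul0r.
  have [b sb ->] := spanO o; rewrite sh ltnS in sb.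
  rewrite (@horner_coef_wide _ n) ?(leq_trans (size_poly _ _)) //.
  rewrite rmorph_sum /=; under eq_bigr => i _.
    rewrite rmorphM rmorphXn /= coef_map rhoi rhoX; over.
  move=> /(gfree (fun i => rhoB b`_i)) sum0.
  have b0 i : (i < n)%N -> exists y, b`_i = pi * y.
    move=> ilt; have [k bk] := natB b`_i; apply.
    rewrite (dvdn_pcharf charFp) -bk sum0 // => j.
    by have [l -> _] := natB b`_j; exact: expf_natr_pchar.
  have [y yb] : exists y : 'I_n -> B, forall i : 'I_n, b`_i = pi * y i.
    exact: (@fin_all_exists 'I_n (fun=> B : Type) (fun i y => b`_i = pi * y)
      (fun i => b0 i (ltn_ord i))).
  exists (\sum_(i < n) iota (y i) * X ^+ i); rewrite mulr_sumr.
  by apply: eq_bigr => i _; rewrite coef_map /= yb rmorphM mulrA.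
split=> //.
- split=> // j v rv pv; rewrite leqNgt; apply/negP => jL; apply: piL'.
  (* An element of nonzero residue is a unit: a lift [w] of the inverse residue inverts it modulo
     pi, and a geometric series corrects the error. So [v] can be cancelled. *)
  have [w rw] := surj (rho v)^-1.
  have /ker[y Dy] : rho (v * w - 1) = 0 by rewrite rmorphB rmorphM /= rw divff // rmorph1 subrr.
  have [|v' vv'] := @add1_nilpotent_unit O (iota pi * y) L.
    by rewrite exprMn piL0 mul0r.
  apply: iota0; rewrite rmorphXn -/L -(subnK (_ : j <= L.-1)%N); last by lia.
  rewrite exprD -[iota pi ^+ j]mulr1 -vv' -Dy addrC subrK.
  have -> : iota pi ^+ j * (v * w * v') = (iota pi ^+ j * v) * (w * v') by ring.
  by rewrite pv mul0r mulr0.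
- by rewrite -[RHS](rmorph0 iota) -sumpi rmorph_sum; apply: eq_bigr => i _; rewrite rmorphXn rmorphD rmorph1.
exists (iota u); first by rewrite rhoi rhou oppr_eq0 oner_eq0.
by rewrite -(rmorph_nat iota) pu rmorphM rmorphXn.
Qed.

End StickelbergerRing.

(* A truncation of the ring of integers of Q_p(zeta_p, zeta_(#|F| - 1)): [unif]
   plays the role of zeta_p - 1 and [teich] of the Teichmueller character. *)
Record teichmuller_ring (p L : nat) (F : finFieldType) := TeichmullerRing {
  tring :> comNzRingType;
  residue : {rmorphism tring -> F};
  unif : tring;
  teich : F -> tring;
  residue_eq0 : forall o, residue o = 0%R <-> exists y, o = (unif * y)%R;
  unif_nilp : (unif ^+ L = 0)%R;
  unif_ann : forall n u, residue u <> 0%R -> (unif ^+ n * u = 0)%R -> L <= n;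
  sum_exp1_unif : (\sum_(i < p) (1 + unif) ^+ i = 0)%R;
  unif_ramified : exists2 u, residue u <> 0%R & (p%:R = unif ^+ (p - 1) * u)%R;
  teichM : forall a b, teich (a * b)%R = (teich a * teich b)%R;
  teich0 : teich 0%R = 0%R;
  teich1 : teich 1%R = 1%R;
  teichK : forall a, residue (teich a) = a
}.

(** The Teichmueller lift of a is the p^N-th power of an arbitrary lift. Elements congruent modulo
    pi have p^n-th powers congruent modulo pi^(n + 1), so for large N the power depends on a alone,
    which makes it multiplicative. *)
Lemma teichmuller_ring_exists (p E M : nat) (F : finFieldType) :
    p \in [pchar F]%R -> 0 < E -> #|F| = p ^ E -> 0 < M ->
  inhabited (teichmuller_ring p (M * (p - 1)) F).
Proof.
move=> charFp E0 cardF M0.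
have [O [rho [pi [surj ker [piL ann] sumpi [u ru pu]]]]] := stickelberger_ring charFp M0.
set L := M * (p - 1) in piL ann *.
have [lift liftK] : exists lift : F -> O, forall a, rho (lift a) = a.
  exact: (@fin_all_exists F (fun=> O : Type) (fun a o => rho o = a) surj).
have expD n x y : rho x = rho y ->
    exists z, (x ^+ (p ^ n) - y ^+ (p ^ n) = pi ^+ n.+1 * z)%R.
  move=> xy; elim: n => [|n [z IH]].
    by apply/ker; rewrite rmorphB xy subrr.
  rewrite expnSr !exprM subrXX.
  have /ker[w ->] : rho (\sum_(i < p) (x ^+ (p ^ n)) ^+ (p.-1 - i) * (y ^+ (p ^ n)) ^+ i)%R = 0%R.
    rewrite rmorph_sum (eq_bigr (fun=> rho (y ^+ (p ^ n) ^+ p.-1)%R)) => [|i _].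
      by rewrite sumr_const card_ord -mulr_natr pcharf0 // mulr0.
    rewrite rmorphM !rmorphXn /= xy -exprD subnK //.
    by have := ltn_ord i; lia.
  by exists (z * w)%R; rewrite IH [in RHS]exprS; ring.
(* A multiple of E, so that the p^N-th power is the identity on F, and at least L, so that pi^(N +
   1) vanishes. *)
pose N := E * L.
have expN x y : rho x = rho y -> (x ^+ (p ^ N) = y ^+ (p ^ N))%R.
  move=> /(expD N)[z Dz]; apply/eqP; rewrite -subr_eq0 Dz.
  by rewrite -(subnK (_ : L <= N.+1)) ?exprD ?piL ?mulr0 ?mul0r // /N; nia.
have expFN (a : F) : (a ^+ (p ^ N) = a)%R.
  rewrite /N expnM -cardF; elim: L {N piL ann expN} => [|k IH]; first by rewrite expr1.
  by rewrite expnSr exprM IH expf_card.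
constructor; apply: (@TeichmullerRing p L F O rho pi (fun a => lift a ^+ (p ^ N))%R) => //.
- by move=> n v /eqP; apply: ann.
- by exists u => //; apply/eqP.
- by move=> a b; rewrite -exprMn; apply: expN; rewrite rmorphM !liftK.
- rewrite (expN _ 0%R) ?liftK ?rmorph0 // expr0n expn_eq0.
  by rewrite eqn0Ngt (prime_gt0 (pcharf_prime charFp)).
- by rewrite (expN _ 1%R) ?expr1n // liftK rmorph1.
by move=> a; rewrite rmorphXn liftK expFN.
Qed.

(** * Valuations in the truncated ring *)

Section Valuation.
Local Open Scope ring_scope.
Variables (p L : nat) (F : finFieldType) (O : teichmuller_ring p L F).
Local Notation rho := (residue O).
Local Notation pi := (unif O).
Implicit Types x y : O.

(** A relation and not a function: 0 has [val_eq] n for every n >= L. This is why the comparison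
    lemmas ask for valuations below L. *)
Definition val_eq x n := exists2 u, rho u <> 0 & x = pi ^+ n * u.
Definition val_ge x n := exists y, x = pi ^+ n * y.

Lemma residue_unit u : rho u <> 0 -> exists v, u * v = 1.
Proof.
move=> ru; pose w := teich O (rho u)^-1.
have /residue_eq0[y Dy] : rho (u * w - 1) = 0.
  by rewrite rmorphB rmorphM /= teichK divff ?rmorph1 ?subrr //; apply/eqP.
have [|v vy] := @add1_nilpotent_unit O (pi * y) L.
  by rewrite exprMn unif_nilp mul0r.
by exists (w * v); rewrite mulrA -[u * w](subrK 1) Dy addrC.
Qed.

Lemma val_eqM x y a b : val_eq x a -> val_eq y b -> val_eq (x * y) (a + b).
Proof.
case=> u ru ->; case=> v rv ->; exists (u * v); last by rewrite exprD; ring.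
by rewrite rmorphM => /eqP; rewrite mulf_eq0 => /orP[]/eqP.
Qed.

Lemma val_geM x y a b : val_ge x a -> val_ge y b -> val_ge (x * y) (a + b).
Proof. by case=> u ->; case=> v ->; exists (u * v); rewrite exprD; ring. Qed.

Lemma val_ge_le x a b : (b <= a)%N -> val_ge x a -> val_ge x b.
Proof. by move=> ba [u ->]; exists (pi ^+ (a - b) * u); rewrite mulrA -exprD subnKC. Qed.

Lemma val_geW x a : val_eq x a -> val_ge x a.
Proof. by case=> u _ ->; exists u. Qed.

Lemma val_ge_sum I (r : seq I) (P : pred I) (f : I -> O) n :
  (forall i, P i -> val_ge (f i) n) -> val_ge (\sum_(i <- r | P i) f i) n.
Proof.
move=> H; apply: (big_ind (fun x => val_ge x n)) => //; first by exists 0; rewrite mulr0.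
by move=> x y [u ->] [v ->]; exists (u + v); rewrite mulrDr.
Qed.

Lemma val_eq_ge x a b : (a < L)%N -> val_eq x a -> val_ge x b -> (b <= a)%N.
Proof.
move=> aL [u ru Du] [y Dy]; rewrite leqNgt; apply/negP => ab.
suff: (L <= a)%N by rewrite leqNgt aL.
have rv : rho (u - pi ^+ (b - a) * y) <> 0.
  rewrite rmorphB rmorphM rmorphXn /= (_ : rho pi = 0); last first.
    by apply/residue_eq0; exists 1; rewrite mulr1.
  by rewrite expr0n subn_eq0 leqNgt ab mul0r subr0.
apply: (unif_ann rv (n := a)).
by rewrite mulrBr mulrA -exprD subnKC ?(ltnW ab) // -Du -Dy subrr.
Qed.

Lemma val_eq_inj x a b : (a < L)%N -> (b < L)%N -> val_eq x a -> val_eq x b -> a = b.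
Proof.
move=> aL bL xa xb; apply/eqP; rewrite eqn_leq.
by rewrite (val_eq_ge bL xb (val_geW xa)) (val_eq_ge aL xa (val_geW xb)).
Qed.

Lemma val_dichotomy x n : (exists2 m, (m < n)%N & val_eq x m) \/ val_ge x n.
Proof.
elim: n => [|n [[m mn xm]|[y Dy]]]; first by right; exists x; rewrite mul1r.
  by left; exists m; first exact: ltnW.
have [/residue_eq0[z Dz]|/eqP ry] := eqVneq (rho y) 0.
  by right; exists z; rewrite exprSr -mulrA -Dz.
by left; exists n => //; exists y.
Qed.

Lemma val_eq_divl x y n : (n < L)%N -> val_eq (x * y) n -> exists2 m, (m <= n)%N & val_eq x m.
Proof.
move=> nL xyn; have [//|[z Dx]] := val_dichotomy x n.+1.
have := val_eq_ge nL xyn (b := n.+1); rewrite ltnn => H; suff: false by [].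
by apply: H; exists (z * y); rewrite Dx mulrA.
Qed.

(** The bridge between the two valuations: one factor p is worth p - 1 factors [unif]. *)
Lemma val_eq_natr v n : ~~ (p %| n)%N -> p \in [pchar F] -> val_eq (p ^ v * n)%:R (v * (p - 1)).
Proof.
move=> pn charFp; have [u ru pu] := unif_ramified O.
exists (u ^+ v * n%:R).
  rewrite rmorphM rmorphXn rmorph_nat => /eqP; rewrite mulf_eq0 => /orP[].
    by rewrite expf_eq0 => /andP[_ /eqP].
  by rewrite -(dvdn_pcharf charFp) (negPf pn).
by rewrite natrM natrX pu exprMn -exprM mulnC mulrA.
Qed.

End Valuation.

(** * Traces as linearized polynomials *)

Section FieldTrace.
Local Open Scope ring_scope.
Variables (p : nat) (F : finFieldType).
Hypothesis charFp : p \in [pchar F].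
Let p_pr : prime p := pcharf_prime charFp.

Lemma natr_eq_mod m n : m%:R = n%:R :> F -> (m = n %[mod p])%N.
Proof.
wlog le_mn : m n / (m <= n)%N => [W|] mn.
  by case/orP: (leq_total m n) => le; [exact: W | apply/esym/W].
apply/esym/eqP; rewrite eqn_mod_dvd // (dvdn_pcharf charFp) natrB // mn.
by rewrite subrr.
Qed.

(** The polynomial has degree at most p^n, hence fewer roots than S has elements unless it is 0.
    Only the coefficient of X is needed: it is 1 or the trace under study. *)
Lemma linearized_poly_eq0 (b : nat -> F) n (S : {set F}) :
  (p ^ n.+1 <= #|S|)%N -> (forall x, x \in S -> \sum_(i < n.+1) b i * x ^+ (p ^ i) = 0) ->
  b 0%N = 0.
Proof.
move=> cS rS; pose P := \sum_(i < n.+1) b i *: 'X^(p ^ i).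
have sP : (size P <= p ^ n.+1)%N.
  apply: (big_ind (fun P : {poly F} => size P <= p ^ n.+1)%N); first by rewrite size_poly0.
    by move=> u v su sv; rewrite (leq_trans (size_polyD _ _)) // geq_max su.
  move=> i _; rewrite (leq_trans (size_scale_leq _ _)) // size_polyXn.
  by rewrite ltn_exp2l ?prime_gt1.
have P0 : P = 0.
  apply/eqP; apply: contraTT cS => P0; rewrite -ltnNge cardE.
  apply: leq_trans sP; apply: max_poly_roots => //; last exact: enum_uniq.
  apply/allP=> x; rewrite mem_enum => /rS Sx; rewrite /root -[X in _ == X]Sx horner_sum.
  by apply/eqP/eq_bigr => i _; rewrite hornerZ hornerXn.
have := congr1 (coefp 1) P0; rewrite /= coef0 coef_sum big_ord_recl big1 ?addr0.
  by rewrite coefZ coefXn expn0 mulr1.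
move=> i _; rewrite coefZ coefXn /= /bump /= add1n -{1}(expn0 p).
by rewrite eqn_exp2l ?prime_gt1 // mulr0.
Qed.

(** For q^d = #|F| this is the trace onto the subfield with q elements. It serves both for the
    absolute trace and for the trace onto F_q. *)
Definition field_trace d (q : nat) (a : F) : F := \sum_(i < d) a ^+ (q ^ i).

Lemma field_traceD d n a b :
  field_trace d (p ^ n) (a + b) = field_trace d (p ^ n) a + field_trace d (p ^ n) b.
Proof.
rewrite /field_trace -big_split; apply: eq_bigr => i _.
by rewrite -expnM expfD_pchar.
Qed.

Lemma field_trace0 d n : field_trace d (p ^ n) 0 = 0.
Proof. by apply: (addrI (field_trace d (p ^ n) 0)); rewrite -field_traceD !addr0. Qed.

Lemma field_traceB d n a b :
  field_trace d (p ^ n) (a - b) = field_trace d (p ^ n) a - field_trace d (p ^ n) b.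
Proof. by apply: (addIr (field_trace d (p ^ n) b)); rewrite -field_traceD !subrK. Qed.

Lemma field_trace_natmul d n a k :
  field_trace d (p ^ n) (a *+ k) = field_trace d (p ^ n) a *+ k.
Proof. by elim: k => [|k IH]; rewrite ?mulr0n ?field_trace0 // !mulrS field_traceD IH. Qed.

Lemma sum_expf_pchar I (r : seq I) (f : I -> F) n :
  (\sum_(i <- r) f i) ^+ (p ^ n) = \sum_(i <- r) f i ^+ (p ^ n).
Proof.
elim: r => [|i r IH]; last by rewrite !big_cons expfD_pchar ?IH.
by rewrite !big_nil expr0n expn_eq0 eqn0Ngt prime_gt0.
Qed.

Lemma field_trace_exp d n a : a ^+ ((p ^ n) ^ d) = a ->
  field_trace d (p ^ n) (a ^+ (p ^ n)) = field_trace d (p ^ n) a.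
Proof.
move=> ad; rewrite /field_trace; case: d ad => [|d] ad; first by rewrite !big_ord0.
rewrite big_ord_recr /= -exprM -expnS ad [RHS]big_ord_recl /= expr1 addrC; congr (_ + _).
by apply: eq_bigr => i _; rewrite -exprM -expnS.
Qed.

Lemma field_trace_fix d n a : a ^+ ((p ^ n) ^ d) = a ->
  field_trace d (p ^ n) a ^+ (p ^ n) = field_trace d (p ^ n) a.
Proof.
move=> ad; rewrite -[RHS](field_trace_exp ad) [LHS]sum_expf_pchar.
by apply: eq_bigr => i _; rewrite -!exprM mulnC.
Qed.

End FieldTrace.

(** * The additive character *)

Section AdditiveCharacter.
Local Open Scope ring_scope.
Variables (p E L : nat) (F : finFieldType) (O : teichmuller_ring p L F).
Hypotheses (charFp : p \in [pchar F]) (cardF : #|F| = (p ^ E)%N).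
Local Notation pi := (unif O).
Local Notation rho := (residue O).
Let p_pr : prime p := pcharf_prime charFp.

Local Notation trF := (field_trace E p).

Lemma absolute_traceD a b : trF (a + b) = trF a + trF b :> F.
Proof. by have := field_traceD charFp E 1 a b; rewrite expn1. Qed.

Definition trace_rep (a : F) : nat := find (fun i => i%:R == trF a) (iota 0 p).

Lemma trace_rep_lt a : (trace_rep a < p)%N /\ (trace_rep a)%:R = trF a.
Proof.
have : trF a ^+ p = trF a.
  by have := @field_trace_fix p F charFp E 1 a; rewrite expn1; apply; rewrite -cardF expf_card.
case/(prime_subfieldP charFp) => n np an.
have h : has (fun i => i%:R == trF a) (iota 0 p).
  by apply/hasP; exists n; rewrite ?mem_iota // an.
have := h; rewrite has_find size_iota -/(trace_rep a) => lt; split=> //.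
by have /eqP := nth_find 0%N h; rewrite nth_iota.
Qed.

(** This is zeta_p^(Tr a), with zeta_p = 1 + [unif]. *)
Definition add_char (a : F) : O := (1 + pi) ^+ trace_rep a.

Lemma exp1_unif_p : (1 + pi) ^+ p = 1.
Proof.
by apply/eqP; rewrite -subr_eq0 subrX1 sum_exp1_unif mulr0.
Qed.

Lemma exp1_unif_mod m n : (m = n %[mod p])%N -> (1 + pi) ^+ m = (1 + pi) ^+ n.
Proof.
by rewrite -(expr_mod m exp1_unif_p) => ->; rewrite (expr_mod n exp1_unif_p).
Qed.

Lemma add_charD a b : add_char (a + b) = add_char a * add_char b.
Proof.
rewrite /add_char -exprD; apply/exp1_unif_mod/(natr_eq_mod charFp).
by rewrite natrD !(trace_rep_lt _).2 absolute_traceD.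
Qed.

Lemma add_char_trace0 a : trF a = 0 -> add_char a = 1.
Proof.
move=> ta; rewrite -[RHS](expr0 (1 + pi)); apply/exp1_unif_mod/(natr_eq_mod charFp).
by rewrite (trace_rep_lt _).2 ta.
Qed.

Lemma add_char0 : add_char 0 = 1.
Proof. by apply: add_char_trace0; have := field_trace0 charFp E 1; rewrite expn1. Qed.

(** The usual argument, that (psi(b) - 1) times the sum is 0, fails since psi(b) - 1 is nilpotent.
    Instead, translations by multiples of b show that all p fibres of the trace on K have the same
    size, so the sum is a multiple of 1 + zeta_p + ... + zeta_p^(p - 1) = 0. *)
Lemma sum_add_char_subgroup (K : {set F}) b :
  0 \in K -> (forall x y, x \in K -> y \in K -> x - y \in K) ->
  b \in K -> trF b <> 0 -> \sum_(a in K) add_char a = 0.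
Proof.
move=> K0 KB Kb trb.
have KD x y : x \in K -> y \in K -> x + y \in K.
  by move=> Kx Ky; rewrite -[y]opprK KB // -sub0r KB.
pose N n := #|[set a in K | trace_rep a == n]|.
have NE n : (n < p)%N -> N n = N 0%N.
  move=> np; have [tb tbE] := trace_rep_lt b.
  have [j _ jE] : exists2 j, (j < p)%N & n%:R / trF b = j%:R :> F.
    by apply: (prime_subfieldP charFp); rewrite -tbE prime_subfield_div ?expf_natr_pchar.
  have Kj : b *+ j \in K by elim: (j) => [|i IH]; rewrite ?mulr0n // mulrS KD.
  have trj : trF (b *+ j) = n%:R.
    have := field_trace_natmul charFp E 1 b j; rewrite expn1 => ->.
    by rewrite -[LHS]mulr_natr -jE mulrC divfK //; apply/eqP.
  have repE x m : (m < p)%N -> (trace_rep x == m) = (trF x == m%:R).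
    move=> mp; rewrite -(trace_rep_lt x).2; apply/eqP/eqP => [->//|].
    move/(natr_eq_mod charFp); rewrite !modn_small //; exact: (trace_rep_lt x).1.
  rewrite /N -[RHS](card_imset _ (addIr (b *+ j))); apply: eq_card => x.
  rewrite inE repE //; apply/andP/imsetP => [[Kx /eqP trx]|[y]].
    exists (x - b *+ j); last by rewrite subrK.
    rewrite inE repE ?prime_gt0 // KB //=.
    have := field_traceB charFp E 1 x (b *+ j); rewrite expn1 => ->.
    by rewrite trx trj subrr.
  rewrite inE repE ?prime_gt0 // => /andP[Ky /eqP try] ->.
  by rewrite absolute_traceD try trj add0r KD.
rewrite (partition_big (fun a => Ordinal (trace_rep_lt a).1) predT) //=.
rewrite (eq_bigr (fun n : 'I_p => (1 + pi) ^+ n * (N 0%N)%:R)) => [|n _].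
  by rewrite -mulr_suml sum_exp1_unif mul0r.
rewrite -(NE n) // mulr_natr -sumr_const; apply: eq_big => [a|a /andP[_ /eqP <-]] //.
by rewrite inE -val_eqE.
Qed.

End AdditiveCharacter.

(** The representative of n modulo N in [1, N] for n > 0, and 0 for n = 0. A positive weight must
    not be reduced to 0, as column sums have to stay positive. *)
Definition cycle_rep N n := if n == 0 then 0 else (n - 1) %% N + 1.

Lemma cycle_rep_mod N n : cycle_rep N n = n %[mod N].
Proof. by rewrite /cycle_rep; case: eqP => [->//|n0]; rewrite modnDml subnK //; lia. Qed.

Lemma cycle_rep_le N n : 0 < N -> cycle_rep N n <= N.
Proof. by rewrite /cycle_rep; case: eqP => // _ N0; have := ltn_pmod (n - 1) N0; lia. Qed.

Lemma cycle_rep_eq0 N n : (cycle_rep N n == 0) = (n == 0).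
Proof. by rewrite /cycle_rep; case: (n == 0) => //; rewrite addn1. Qed.

(** * Digit sums in base p *)

Section DigitSum.
Variable p : nat.
Hypothesis p1 : 1 < p.
Let p0 : 0 < p := ltnW p1.

Lemma digsum_wide a n : a < n -> digsum p a = \sum_(i < n) ((a %/ p ^ i) %% p).
Proof.
move=> an; rewrite /digsum -(subnKC an) big_split_ord /= [X in _ = _ + X]big1 ?addn0 // => i _.
rewrite divn_small ?mod0n // (leq_trans (ltn_expl a p1)) // leq_exp2l //; lia.
Qed.

Lemma digsum_rec a : digsum p a = a %% p + digsum p (a %/ p).
Proof.
rewrite (@digsum_wide a a.+2) // big_ord_recl expn0 divn1; congr (_ + _).
rewrite (@digsum_wide _ a.+1); last by rewrite ltnS leq_div.
by apply: eq_bigr => i _; rewrite expnS divnMA.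
Qed.

Lemma digsum0 : digsum p 0 = 0.
Proof. by rewrite /digsum big1 // => i _; rewrite div0n mod0n. Qed.

Lemma digsum_small a : a < p -> digsum p a = a.
Proof. by move=> ap; rewrite digsum_rec modn_small // divn_small // digsum0 addn0. Qed.

Lemma digsum_shift a b : b < p -> digsum p (a * p + b) = digsum p a + b.
Proof.
by move=> bp; rewrite digsum_rec modnMDl modn_small // divnMDl // divn_small // addn0 addnC.
Qed.

Lemma digsumS a : digsum p a.+1 <= (digsum p a).+1.
Proof.
elim/ltn_ind: a => a IH; rewrite {1}(divn_eq a p) -addnS.
have := ltn_pmod a p0; rewrite leq_eqVlt => /orP[/eqP ap|ap]; last first.
  by rewrite digsum_shift // [in X in _ <= X]digsum_rec; lia.
have a0 : 0 < a by case: posnP ap => // ->; rewrite mod0n; lia.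
rewrite ap -mulSnr -[_ * p]addn0 digsum_shift // [in X in _ <= X]digsum_rec.
have := IH (a %/ p); rewrite ltn_Pdiv // => /(_ isT); lia.
Qed.

(** Induction after removing the last digits: a carry trades p units of the last digit for at most
    one more in the digit sum of the rest. *)
Lemma digsumD a b : digsum p (a + b) <= digsum p a + digsum p b.
Proof.
have [n] := ubnP (a + b); elim: n a b => // n IH a b abn.
have [/eqP|ab0] := posnP (a + b).
  by rewrite addn_eq0 => /andP[/eqP-> /eqP->]; rewrite digsum0.
have {IH} IH : digsum p (a %/ p + b %/ p) <= digsum p (a %/ p) + digsum p (b %/ p).
  apply: IH; have := leq_div a p; have := leq_div b p.
  case: (posnP a) => [a0|a0]; last by have := ltn_Pdiv p1 a0; lia.
  have b0 : 0 < b by lia.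
  by have := ltn_Pdiv p1 b0; lia.
rewrite (digsum_rec a) (digsum_rec b) {1}(divn_eq a p) {1}(divn_eq b p) addnACA -mulnDl.
have := ltn_pmod a p0; have := ltn_pmod b p0 => bp ap.
have [lt|le] := ltnP (a %% p + b %% p) p; first by rewrite digsum_shift //; lia.
rewrite -{1}(subnKC le) addnA -mulSnr digsum_shift; last by lia.
have := digsumS (a %/ p + b %/ p); lia.
Qed.

Lemma digsum_sum I (r : seq I) (P : pred I) (f : I -> nat) :
  digsum p (\sum_(i <- r | P i) f i) <= \sum_(i <- r | P i) digsum p (f i).
Proof.
apply: (big_ind2 (fun x y => digsum p x <= y)) => //; first by rewrite digsum0.
by move=> x1 x2 y1 y2 le1 le2; rewrite (leq_trans (digsumD _ _)) ?leq_add.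
Qed.

Lemma digsum_split n a b : b < p ^ n -> digsum p (a * p ^ n + b) = digsum p a + digsum p b.
Proof.
elim: n a b => [|n IH] a b; first by case: b; rewrite // muln1 digsum0 !addn0.
move=> bn; have bp : b %/ p < p ^ n by rewrite ltn_divLR // -expnSr.
rewrite {1}(divn_eq b p) expnSr mulnA addnA -mulnDl digsum_shift ?ltn_pmod // IH //.
by rewrite [in RHS](digsum_rec b); lia.
Qed.

Lemma digsum_expn n : digsum p (p ^ n) = 1.
Proof.
have := @digsum_split n 1 0; rewrite expn_gt0 p0 mul1n digsum0 !addn0 => -> //.
exact: digsum_small.
Qed.

(** Each digit of p^n - 1 - r is p - 1 minus the corresponding digit of r. *)
Lemma digsum_compl n r : r < p ^ n -> digsum p r + digsum p (p ^ n - 1 - r) = n * (p - 1).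
Proof.
elim: n r => [|n IH] r rn; first by case: r rn => // _; rewrite digsum0.
have rp : r %/ p < p ^ n by rewrite ltn_divLR // -expnSr.
have rm := ltn_pmod r p0.
have -> : p ^ n.+1 - 1 - r = (p ^ n - 1 - r %/ p) * p + (p - 1 - r %% p).
  have Dr := divn_eq r p; move: rm rp Dr; rewrite expnSr.
  move: (r %% p) (r %/ p) (p ^ n) => b a q bp aq ->.
  have : a.+1 * p <= q * p by rewrite leq_mul2r aq orbT.
  rewrite !mulnBl mulSn; lia.
rewrite digsum_shift; last by lia.
by have := IH _ rp; rewrite [digsum p r]digsum_rec mulSn; lia.
Qed.

Lemma digsum_pred_expn n : digsum p (p ^ n - 1) = n * (p - 1).
Proof. by rewrite -(@digsum_compl n 0) ?expn_gt0 ?p0 // digsum0 subn0. Qed.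

Lemma digsum_mod a : digsum p a = a %[mod p - 1].
Proof.
elim/ltn_ind: a => a IH; have [->|a0] := posnP a; first by rewrite digsum0.
rewrite digsum_rec -modnDmr IH ?ltn_Pdiv // modnDmr.
have Da : a = a %/ p * (p - 1) + (a %% p + a %/ p); last by rewrite [in RHS]Da modnMDl.
have := leq_pmulr (a %/ p) p0; have := divn_eq a p; rewrite mulnBr; lia.
Qed.

(** The lowest nonzero digit is decreased by one, without borrowing. Gauss sums are built up along
    these steps. *)
Lemma digsum_decr r : 0 < r -> exists2 j, p ^ j <= r & digsum p r = (digsum p (r - p ^ j)).+1.
Proof.
elim/ltn_ind: r => r IH r0; have [rm|rm] := posnP (r %% p); last first.
  exists 0 => //; have rp := ltn_pmod r p0.
  have -> : r - p ^ 0 = r %/ p * p + (r %% p - 1) by rewrite {1}(divn_eq r p) expn0 addnBA.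
  by rewrite digsum_shift 1?digsum_rec; lia.
have Dr : r = r %/ p * p by rewrite {1}(divn_eq r p) rm addn0.
have r'0 : 0 < r %/ p by rewrite lt0n; apply: contraTN r0 => /eqP r'; rewrite Dr r'.
have [||j le eq] := IH (r %/ p); rewrite ?ltn_Pdiv //.
exists j.+1; first by rewrite Dr expnSr leq_mul2r le orbT.
rewrite [in RHS]Dr expnSr -mulnBl [digsum p r]digsum_rec rm add0n eq.
by rewrite -[_ * p]addn0 digsum_shift // addn0.
Qed.

(** For n = a p^E + b, passing from n to a + b preserves the class modulo p^E - 1 and positivity,
    and does not raise the digit sum. Iteration ends below p^E. *)
Lemma digsum_cycle_rep E n : 0 < E -> digsum p (cycle_rep (p ^ E - 1) n) <= digsum p n.
Proof.
move=> E0; have Q1 : 1 < p ^ E by rewrite -(expn0 p) ltn_exp2l.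
elim/ltn_ind: n => n IH; have [nQ|Qn] := ltnP n (p ^ E).
  rewrite /cycle_rep; case: eqP => [->//|n0]; rewrite modn_small ?subnK //; lia.
have Dn := divn_eq n (p ^ E); set a := n %/ p ^ E in Dn; set b := n %% p ^ E in Dn.
have bQ : b < p ^ E by rewrite ltn_pmod // ltnW.
have a0 : 0 < a by rewrite divn_gt0 // ltnW.
have abn : a + b < n by rewrite Dn; nia.
have -> : cycle_rep (p ^ E - 1) n = cycle_rep (p ^ E - 1) (a + b).
  rewrite /cycle_rep !ifF; try lia.
  congr (_ + _); rewrite Dn.
  have -> : a * p ^ E + b - 1 = a * (p ^ E - 1) + (a + b - 1) by nia.
  by rewrite modnMDl.
by rewrite (leq_trans (IH _ abn)) // Dn digsum_split // digsumD.
Qed.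

End DigitSum.

(** * Power sums of Teichmueller lifts *)

Section TeichmullerSums.
Local Open Scope ring_scope.
Variables (p L : nat) (F : finFieldType) (O : teichmuller_ring p L F).
Local Notation rho := (residue O).
Local Notation tau := (teich O).

Lemma teichX a n : tau (a ^+ n) = tau a ^+ n.
Proof. by elim: n => [|n IH]; rewrite ?expr0 ?teich1 // !exprS teichM IH. Qed.

Lemma teich_eq0_exp n : (0 < n)%N -> tau 0 ^+ n = 0.
Proof. by move=> n0; rewrite teich0 expr0n gtn_eqF. Qed.

(** If some c0 in K has c0^n != 1, scaling the summation variable by c0 multiplies the sum by
    tau(c0^n), and 1 - tau(c0^n) is a unit as its residue is nonzero. The convention 0^0 = 1 yields
    q at n = 0. *)
Lemma sum_teich_subfield (q : nat) (K : {set F}) n :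
    (1 < q)%N -> #|K| = q -> (forall c, (c \in K) = (c ^+ q == c)) ->
  \sum_(c in K) tau c ^+ n =
    (if n == 0 then q else if (q - 1 %| n)%N then (q - 1)%N else 0%N)%:R.
Proof.
move=> q1 cK KE; have q0 := ltnW q1.
have K0 : 0 \in K by rewrite KE expr0n gtn_eqF.
have Kexp c : c \in K -> c != 0 -> c ^+ (q - 1) = 1.
  by rewrite KE => /eqP cq c0; apply: (mulfI c0); rewrite -exprS subn1 prednK ?cq ?mulr1.
case: posnP => [->|n0].
  by rewrite (eq_bigr (fun=> 1)) ?sumr_const ?cK // => c _; rewrite expr0.
rewrite (bigD1 0) //= teich_eq0_exp // add0r.
have cK' : #|[pred c | (c \in K) && (c != 0)]| = (q - 1)%N.
  have := cardD1 0 K; rewrite K0 cK => ->; rewrite add1n subn1 /=.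
  by apply: eq_card => c; rewrite !inE andbC.
have [/dvdnP[k ->]|ndvd] := boolP (q - 1 %| n)%N.
  rewrite (eq_bigr (fun=> 1)) => [|c /andP[Kc c0]]; first by rewrite sumr_const cK'.
  by rewrite -teichX mulnC exprM Kexp // expr1n teich1.
(* Otherwise all q - 1 nonzero elements of K would be roots of X^d - 1 with d = n mod (q - 1), and 0
   < d < q - 1. *)
have [c0 /andP[Kc0 c00] c0n] : exists2 c, (c \in K) && (c != 0) & c ^+ n != 1.
  apply/exists_inP; apply: contraNT ndvd => /exists_inPn rootK.
  have q10 : (0 < q - 1)%N by rewrite subn_gt0.
  rewrite /dvdn; apply/negPn/negP; rewrite -lt0n => n'0.
  have := @max_unity_roots _ _ (enum [pred c | (c \in K) && (c != 0)]) n'0.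
  rewrite -cardE cK' enum_uniq => H; suff: (q - 1 <= n %% (q - 1))%N.
    by rewrite leqNgt ltn_pmod.
  apply: H => //; apply/allP => c; rewrite mem_enum => Kc; apply/unity_rootP.
  have := rootK c Kc; rewrite negbK => /eqP cn; case/andP: Kc => Kc c0.
  by move: cn; rewrite {1}(divn_eq n (q - 1)) exprD mulnC exprM Kexp // expr1n mul1r.
set S := bigop _ _ _.
have SE : S = tau (c0 ^+ n) * S.
  rewrite /S mulr_sumr (reindex_onto (fun c => c0 * c) (fun c => c0^-1 * c)) /=.
    apply: eq_big => [c|c _]; last by rewrite teichM exprMn teichX.
    rewrite mulKf // eqxx andbT mulf_eq0 negb_or c00 /= !KE exprMn.
    move: Kc0; rewrite KE => /eqP ->; congr (_ && _).
    by apply/eqP/eqP => [/(mulfI c00)|->].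
  by move=> c _; rewrite mulVKf.
have [u /= Du] : exists u, (1 - tau (c0 ^+ n)) * u = 1.
  apply: residue_unit; rewrite rmorphB rmorph1 teichK => /eqP.
  by rewrite subr_eq0 eq_sym (negPf c0n).
have S0 : (1 - tau (c0 ^+ n)) * S = 0 by rewrite mulrBl mul1r -SE subrr.
by rewrite -[S]mul1r -Du mulrAC S0 mul0r.
Qed.

Lemma sum_teich n : \sum_c tau c ^+ n =
  (if n == 0 then #|F| else if (#|F| - 1 %| n)%N then (#|F| - 1)%N else 0%N)%:R.
Proof.
have F1 := finNzRing_gt1 F.
rewrite -(@sum_teich_subfield #|F| [set: F] n) ?cardsT //; first by apply: eq_bigl => c; rewrite inE.
by move=> c; rewrite expf_card inE eqxx.
Qed.

Lemma teich_expQ a : a != 0 -> tau a ^+ (#|F| - 1) = 1.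
Proof.
move=> a0; rewrite -teichX -[RHS](teich1 O); congr (tau _).
apply: (mulfI a0); rewrite -exprS subn1 prednK ?expf_card ?mulr1 //.
exact: ltnW (finNzRing_gt1 F).
Qed.

End TeichmullerSums.

Lemma ndvdn_between N n : N < n -> n < N + N -> (N %| n) = false.
Proof. by move=> Nn nN; apply/negP => /dvdnP[[|[|k]]]; nia. Qed.

(** * Gauss sums and Stickelberger's theorem *)

Section GaussSums.
Local Open Scope ring_scope.
Variables (p E L : nat) (F : finFieldType) (O : teichmuller_ring p L F).
Hypotheses (charFp : p \in [pchar F]) (cardF : #|F| = (p ^ E)%N) (E0 : (0 < E)%N).
Hypothesis EL : (E * (p - 1) < L)%N.
Local Notation rho := (residue O).
Local Notation tau := (teich O).
Local Notation pi := (unif O).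
Local Notation psi := (add_char E O).
Local Notation Q := #|F|.

Let p_pr : prime p := pcharf_prime charFp.
Let p1 : (1 < p)%N := prime_gt1 p_pr.
Let Q1 : (1 < Q)%N := finNzRing_gt1 F.
Let psiD a b : psi (a + b) = psi a * psi b := add_charD O charFp cardF a b.
Let psi0 : psi 0 = 1 := add_char0 O charFp cardF.

(** The Gauss sum of tau^(- r), with the exponent shifted by #|F| - 1; the sign makes its valuation
    the digit sum of r itself. *)
Definition gauss_sum r : O := \sum_a tau a ^+ (Q - 1 - r) * psi a.

Lemma residue_natrQ : rho Q%:R = 0.
Proof. by rewrite rmorph_nat cardF natrX (pcharf0 charFp) expr0n gtn_eqF. Qed.

Lemma absolute_trace_neq0 : exists b : F, field_trace E p b <> 0.
Proof.
have [/forallP H|] := boolP [forall b : F, field_trace E p b == 0]; last first.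
  by move/forallPn=> [b /eqP]; exists b.
have : (1 : F) = 0; last by move/eqP; rewrite oner_eq0.
apply: (@linearized_poly_eq0 _ _ charFp (fun=> 1) E.-1 [set: F]).
  by rewrite cardsT cardF prednK.
move=> x _; rewrite prednK // -[RHS](eqP (H x)); apply: eq_bigr => i _.
by rewrite mul1r.
Qed.

Lemma sum_add_char : \sum_a psi a = 0.
Proof.
have [b trb] := absolute_trace_neq0.
rewrite -[RHS](@sum_add_char_subgroup p E L F O charFp cardF [set: F] b) ?inE //.
  by apply: eq_bigl => a; rewrite inE.
by move=> x y _ _; rewrite inE.
Qed.

Lemma sum_add_char_scale c : \sum_b psi (b * c) = if c == 0 then Q%:R else 0.
Proof.
have [->|c0] := eqVneq c 0.
  by under eq_bigr => b _ do rewrite mulr0 psi0; rewrite sumr_const.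
by rewrite -[RHS]sum_add_char [RHS](reindex_inj (mulIf c0)).
Qed.

(** [J] is a Jacobi sum. The product is grouped by t = a + b: for t != 0, scaling by t extracts [J],
    and for t = 0 the sum vanishes because A + B lies strictly between #|F| - 1 and its double. *)
Lemma gauss_sum_mul r s : (0 < r)%N -> (0 < s)%N -> (r + s < Q - 1)%N ->
  exists J, gauss_sum (r + s) * J = gauss_sum r * gauss_sum s.
Proof.
move=> r0 s0 rsQ; set A := (Q - 1 - r)%N; set B := (Q - 1 - s)%N.
pose J := \sum_a tau a ^+ A * tau (1 - a) ^+ B.
exists J; rewrite /gauss_sum mulr_suml [RHS]mulr_suml.
transitivity (\sum_t \sum_a psi t * (tau a ^+ A * tau (t - a) ^+ B)); last first.
  rewrite exchange_big /=; apply: eq_bigr => a _.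
  rewrite mulr_sumr (reindex_inj (addrI a)); apply: eq_bigr => b _.
  by rewrite psiD addrC addKr; ring.
apply: eq_bigr => t _; rewrite -mulr_sumr [LHS]mulrAC [LHS]mulrC; congr (_ * _).
have [->|t0] := eqVneq t 0.
  rewrite teich_eq0_exp ?mul0r; last by lia.
  rewrite (eq_bigr (fun a => tau a ^+ (A + B) * tau (-1) ^+ B)) => [|a _].
    rewrite -mulr_suml sum_teich /A /B gtn_eqF; last by lia.
    by rewrite ndvdn_between ?mul0r //; lia.
  by rewrite sub0r -[- a]mulN1r teichM exprMn exprD mulrA mulrAC.
rewrite (reindex_inj (mulfI t0)) mulr_sumr; apply: eq_bigr => a _.
have -> : t - t * a = t * (1 - a) by ring.
rewrite !teichM !exprMn.
have -> : (Q - 1 - (r + s))%N = (A + B - (Q - 1))%N by rewrite /A /B; lia.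
have tE : tau t ^+ (A + B) = tau t ^+ (A + B - (Q - 1)).
  have AB : (Q - 1 <= A + B)%N by rewrite /A /B; lia.
  by rewrite -[in LHS](subnK AB) exprD teich_expQ // mulr1.
by rewrite -tE exprD mulrACA.
Qed.

(** The classical g(chi) g(chi^-1) = chi(-1) #|F|. Scaling one variable by the other, b, leaves for
    each c the sum of psi(b (c + 1)) over b != 0, which is #|F| - 1 for c = -1 and -1 otherwise. *)
Lemma gauss_sum_compl r : (0 < r)%N -> (r < Q - 1)%N ->
  gauss_sum r * gauss_sum (Q - 1 - r) = tau (-1) ^+ (Q - 1 - r) * Q%:R.
Proof.
move=> r0 rQ; rewrite /gauss_sum subKn ?(ltnW rQ) // mulrC mulr_suml.
transitivity (\sum_b \sum_(c | b != 0) tau c ^+ (Q - 1 - r) * psi (b * (c + 1))).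
  apply: eq_bigr => b _; have [->|b0] := eqVneq b 0.
    by rewrite teich_eq0_exp // !mul0r big_pred0.
  rewrite mulr_sumr (reindex_inj (mulfI b0)); apply: eq_bigr => c _.
  rewrite mulrDr mulr1 psiD teichM exprMn.
  have := teich_expQ O b0; rewrite -{1}(subnK (ltnW rQ)) exprD => tb.
  transitivity ((tau b ^+ (Q - 1 - r) * tau b ^+ r) * (tau c ^+ (Q - 1 - r) * (psi (b * c) * psi b))).
    by ring.
  by rewrite tb mul1r.
under eq_bigr => b _ do rewrite big_mkcond.
rewrite exchange_big /=.
rewrite (eq_bigr (fun c => tau c ^+ (Q - 1 - r) * (if c + 1 == 0 then Q%:R else 0)
                         - tau c ^+ (Q - 1 - r))) => [|c _]; last first.
  rewrite -sum_add_char_scale -[X in _ = _ - X]mulr1 -mulrBr -big_mkcond /= -mulr_sumr.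
  by congr (_ * _); rewrite [in RHS](bigD1 0) //= mul0r psi0 [RHS]addrC addKr.
rewrite sumrB sum_teich gtn_eqF ?subn_gt0 // gtnNdvd ?subn_gt0 //; last by lia.
rewrite subr0 (bigD1 (-1)) //= addNr eqxx big1 ?addr0 // => c cN.
by rewrite addr_eq0 (negPf cN) mulr0.
Qed.

Lemma exp1D_expand n : exists z, (1 + pi) ^+ n = 1 + pi * (n%:R + pi * z).
Proof.
elim: n => [|n [z IH]]; first by exists 0; ring.
by exists (n%:R + (1 + pi) * z); rewrite exprS IH -natr1; ring.
Qed.

(** Modulo pi^2, psi(a) is 1 + pi Tr(a). The constant term sums to 0, so the residue of the cofactor
    of pi is the sum of a^(- p^j) Tr(a) over nonzero a. Expanding the trace, only its term a^(p^j)
    contributes, with #|F| - 1 = -1. *)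
Lemma val_gauss_sum_expn j : (p ^ j < Q - 1)%N -> val_eq (gauss_sum (p ^ j)) 1.
Proof.
move=> jQ; pose m := (Q - 1 - p ^ j)%N.
have m0 : (0 < m)%N by rewrite subn_gt0.
have pj0 i : (0 < p ^ i)%N by rewrite expn_gt0 prime_gt0.
have [z zE] : exists z : F -> O, forall a, psi a = 1 + pi * ((trace_rep p E a)%:R + pi * z a).
  exact: (@fin_all_exists F (fun=> O : Type) _ (fun a => exp1D_expand (trace_rep p E a))).
exists (\sum_a tau a ^+ m * ((trace_rep p E a)%:R + pi * z a)); last first.
  rewrite expr1 /gauss_sum -/m.
  rewrite (eq_bigr (fun a => tau a ^+ m + pi * (tau a ^+ m * ((trace_rep p E a)%:R + pi * z a)))).
    rewrite big_split /= -mulr_sumr sum_teich gtn_eqF // gtnNdvd ?add0r //.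
    by rewrite /m; have := pj0 j; lia.
  by move=> a _; rewrite zE; ring.
rewrite rmorph_sum /=.
have rhopi : rho pi = 0 by apply/residue_eq0; exists 1; rewrite mulr1.
have Qj : (p ^ j < p ^ E)%N by rewrite -cardF; lia.
have jE : (j < E)%N by rewrite ltn_exp2l in Qj.
rewrite (eq_bigr (fun a : F => \sum_(i < E) a ^+ (m + p ^ i))) => [|a _]; last first.
  rewrite rmorphM rmorphXn teichK rmorphD rmorphM /= rhopi mul0r addr0 rmorph_nat.
  rewrite (trace_rep_lt charFp cardF a).2 mulr_sumr.
  by apply: eq_bigr => i _; rewrite exprD.
have sumF n : \sum_(a : F) a ^+ n = rho (\sum_a tau a ^+ n).
  by rewrite rmorph_sum; apply: eq_bigr => a _; rewrite rmorphXn teichK.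
rewrite exchange_big (bigD1 (Ordinal jE)) //= sumF sum_teich /m subnK ?(ltnW jQ) //.
rewrite gtn_eqF ?(leq_trans _ jQ) // dvdnn rmorph_nat natrB ?(ltnW Q1) //.
rewrite -(rmorph_nat rho Q) residue_natrQ sub0r big1 ?addr0.
  by apply/eqP; rewrite oppr_eq0 oner_neq0.
move=> i ij; rewrite sumF sum_teich gtn_eqF ?addn_gt0 ?pj0 ?orbT //.
have iE : (p ^ i < Q)%N by rewrite cardF ltn_exp2l.
have : (p ^ i != p ^ j)%N by rewrite eqn_exp2l // -val_eqE in ij *.
rewrite /m; have := pj0 i; have := pj0 j.
move: (p ^ i)%N (p ^ j)%N iE jQ => a b aQ bQ b0 a0 ab.
have [lt|le] := ltnP a b; first by rewrite gtnNdvd ?rmorph0 //; lia.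
by rewrite ndvdn_between ?rmorph0 //; lia.
Qed.

(** Powers of p are split off r one at a time. Only an upper bound results, since the Jacobi sum
    multiplying [gauss_sum r] has unknown valuation. *)
Lemma val_gauss_sum_le r : (0 < r)%N -> (r < Q - 1)%N ->
  exists2 n, (n <= digsum p r)%N & val_eq (gauss_sum r) n.
Proof.
have [N] := ubnP r; elim: N r => // N IH r rN r0 rQ.
have [j jr Dr] := digsum_decr p1 r0.
have pj0 : (0 < p ^ j)%N by rewrite expn_gt0 prime_gt0.
have [/eqP r'0|r'0] := posnP (r - p ^ j).
  have <- : (p ^ j)%N = r by apply/eqP; rewrite eqn_leq jr.
  exists 1%N; first by rewrite digsum_expn.
  by apply: val_gauss_sum_expn; apply: leq_ltn_trans rQ.
have [|||n nle vn] := IH (r - p ^ j)%N; try lia.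
have [|J] := @gauss_sum_mul (r - p ^ j) (p ^ j) r'0 pj0; rewrite ?subnK //.
have vj : val_eq (gauss_sum (p ^ j)) 1 by apply: val_gauss_sum_expn; lia.
have := val_eqM vn vj => + JE; rewrite -JE => /val_eq_divl.
have dle : (digsum p r <= E * (p - 1))%N.
  by rewrite -(@digsum_compl p p1 E r) ?leq_addr // -cardF; lia.
case; first by lia.
by move=> n' n'le ?; exists n' => //; lia.
Qed.

Lemma val_natrQ : val_eq (Q%:R : O) (E * (p - 1)).
Proof.
rewrite cardF -[(p ^ E)%N]muln1; apply: val_eq_natr => //.
by rewrite dvdn1 gtn_eqF.
Qed.

(* The digit sums of [r] and [Q - 1 - r] add up to the valuation of [Q], so
   both upper bounds [val_gauss_sum_le] are attained. *)
Lemma val_gauss_sum r : (0 < r)%N -> (r < Q - 1)%N -> val_eq (gauss_sum r) (digsum p r).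
Proof.
move=> r0 rQ; have [n nle vn] := val_gauss_sum_le r0 rQ.
have [||n' n'le vn'] := @val_gauss_sum_le (Q - 1 - r); try lia.
have := val_eqM vn vn'; rewrite gauss_sum_compl // => v.
have v' : val_eq (tau (-1) ^+ (Q - 1 - r) * Q%:R) (0 + E * (p - 1)).
  apply: val_eqM val_natrQ; exists (tau (-1) ^+ (Q - 1 - r)); rewrite ?mul1r //.
  by rewrite -teichX teichK; apply/eqP; rewrite expf_neq0 // oppr_eq0 oner_neq0.
have compl : (digsum p r + digsum p (Q - 1 - r) = E * (p - 1))%N.
  by rewrite cardF digsum_compl // -cardF; lia.
have nn' : (n + n' = 0 + E * (p - 1))%N by apply: val_eq_inj v v'; lia.
by have -> : digsum p r = n by lia.
Qed.

(** Fourier inversion on the nonzero elements gives c_r = g_r / (#|F| - 1) for 0 < r < #|F| - 1. The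
    trivial character has coefficient -1 / (#|F| - 1), to be shared between r = 0 and r = #|F| - 1.
    Since psi(0) = 1 forces c_0 = 1, the last coefficient is - #|F| / (#|F| - 1), whose valuation is
    again the digit sum. *)
Lemma add_char_expansion : exists c : nat -> O,
  (forall a, psi a = \sum_(r < Q) c r * tau a ^+ r) /\
  (forall r, (r < Q)%N -> val_eq (c r) (digsum p r)).
Proof.
have [v vQ] : exists v : O, (Q%:R - 1) * v = 1.
  apply: residue_unit; rewrite rmorphB residue_natrQ rmorph1 sub0r.
  by apply/eqP; rewrite oppr_eq0 oner_neq0.
have rv : rho v <> 0.
  move=> rv; have /eqP := congr1 rho vQ.
  by rewrite rmorphM rv mulr0 rmorph1 eq_sym oner_eq0.
have Qsplit : Q = (Q - 2).+2 by lia.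
pose c r := if r == 0%N then 1 else if r == (Q - 1)%N then - (Q%:R * v) else v * gauss_sum r.
exists c; split=> [a|r rQ]; last first.
  rewrite /c; case: (posnP r) => [->|r0].
    by rewrite digsum0; exists 1; rewrite ?mul1r // rmorph1; apply/eqP/oner_neq0.
  case: eqP => [->|/eqP rQ1].
    rewrite {2}cardF digsum_pred_expn //.
    rewrite -mulrN -[(E * _)%N]addn0; apply: val_eqM val_natrQ _.
    by exists (- v); rewrite ?mul1r // rmorphN => /eqP; rewrite oppr_eq0 => /eqP.
  rewrite -[digsum p r]add0n; apply: val_eqM; first by exists v; rewrite ?mul1r.
  by apply: val_gauss_sum => //; lia.
rewrite Qsplit big_ord_recl big_ord_recr /= expr0 mulr1 /c eqxx.
have -> : (bump 0 (Q - 2) = Q - 1)%N by rewrite /bump; lia.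
rewrite eqxx ifF; last by lia.
have [->|a0] := eqVneq a 0.
  rewrite psi0 teich_eq0_exp ?mulr0 ?addr0 ?subn_gt0 // big1 ?addr0 // => i _.
  by rewrite teich_eq0_exp ?mulr0.
rewrite teich_expQ // mulr1.
rewrite (eq_bigr (fun i : 'I_(Q - 2) => v * \sum_(b | b != 0) psi b * tau (a / b) ^+ i.+1)).
  rewrite -mulr_sumr exchange_big /=.
  have geo b : b != 0 ->
      \sum_(i < Q - 2) psi b * tau (a / b) ^+ i.+1 = psi b * ((Q%:R - 1) * (b == a)%:R - 1).
    move=> b0; rewrite -mulr_sumr; congr (_ * _).
    have -> : \sum_(i < Q - 2) tau (a / b) ^+ i.+1 = \sum_(i < Q - 1) tau (a / b) ^+ i - 1.
      rewrite (_ : Q - 1 = (Q - 2).+1)%N; last by lia.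
      by rewrite big_ord_recl expr0 addrC addKr.
    congr (_ - _); case: eqVneq => [->|ba].
      rewrite divff // (eq_bigr (fun=> 1)) => [|i _]; last by rewrite teich1 expr1n.
      by rewrite sumr_const card_ord mulr1 natrB // ltnW.
    have ab1 : a / b != 1 by apply: contraNneq ba => /divr1_eq ->.
    have [u Du] : exists u, (tau (a / b) - 1) * u = 1.
      by apply: residue_unit; rewrite rmorphB teichK rmorph1; apply/eqP; rewrite subr_eq0.
    rewrite mulr0 -[LHS]mul1r -Du mulrAC -subrX1 teich_expQ ?subrr ?mul0r //.
    by rewrite mulf_neq0 // invr_eq0.
  rewrite (eq_bigr _ geo) (bigD1 a) //= eqxx.
  rewrite (eq_bigr (fun b => - psi b)) => [|b /andP[_ /negPf ->]]; last by rewrite mulr0 sub0r mulrN1.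
  have := sum_add_char; rewrite (bigD1 0) //= (bigD1 a) //= psi0.
  rewrite sumrN; set S := bigop _ _ _ => S0.
  have -> : S = - 1 - psi a by apply/eqP; rewrite -subr_eq0 -S0; apply/eqP; ring.
  transitivity (1 + (psi a * ((Q%:R - 1) * v) + v) - Q%:R * v); last first.
    move: (psi a) (Q%:R : O) {S0} => x q; ring.
  rewrite vQ mulr1; transitivity (psi a + (1 - (Q%:R - 1) * v)); first by rewrite vQ subrr addr0.
  by move: (Q%:R : O) => q; ring.
move=> i _; have iQ : (i.+1 < Q - 1)%N.
  by rewrite (_ : Q - 1 = (Q - 2).+1)%N ?ltnS //; lia.
rewrite /bump /= add1n ltn_eqF //.
rewrite -mulrA; congr (_ * _); rewrite /gauss_sum mulr_suml (bigD1 0) //=.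
rewrite teich_eq0_exp ?mul0r ?add0r ?subn_gt0 //.
apply: eq_bigr => b b0.
have tb : tau b ^+ (Q - 1 - i.+1) = tau b^-1 ^+ i.+1.
  have bb : (tau b * tau b^-1) ^+ i.+1 = 1 by rewrite -teichM divff // teich1 expr1n.
  by rewrite -[LHS]mulr1 -bb exprMn mulrA -exprD (subnK (ltnW iQ)) teich_expQ // mul1r.
by rewrite tb teichM exprMn; ring.
Qed.

End GaussSums.

Lemma sum_ord_mul (R : nmodType) (f : nat -> R) e m :
  (\sum_(i < e * m) f i = \sum_(j < m) \sum_(i < e) f (e * j + i))%R.
Proof.
elim: m => [|m IH]; first by rewrite muln0 !big_ord0.
rewrite big_ord_recr /= -IH -!(big_mkord xpredT f) mulnSr.
rewrite (big_cat_nat _ (leq_addr e (e * m))) //= ; congr (_ + _)%R.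
by rewrite -{1}[e * m]add0n big_addn addKn big_mkord; apply: eq_bigr => i _; rewrite addnC.
Qed.

(** * Artin-Schreier equations and the trace onto F_q *)

Section ArtinSchreier.
Local Open Scope ring_scope.
Variables (p e m L : nat) (F : finFieldType) (O : teichmuller_ring p L F).
Hypotheses (charFp : p \in [pchar F]) (cardF : #|F| = ((p ^ e) ^ m)%N).
Hypotheses (e0 : (0 < e)%N) (m0 : (0 < m)%N).
Local Notation q := (p ^ e)%N.
Let p_pr : prime p := pcharf_prime charFp.
Let p1 : (1 < p)%N := prime_gt1 p_pr.
Local Notation trq := (field_trace m q).

Lemma card_roots_lt (P : {poly F}) : P != 0 -> (#|[set x | root P x]| < size P)%N.
Proof.
move=> P0; rewrite cardE; apply: max_poly_roots => //; last exact: enum_uniq.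
by apply/allP=> x; rewrite mem_enum inE.
Qed.

Definition fixed_subfield : {set F} := [set c | c ^+ q == c].

Let q1 : (1 < q)%N. Proof. by rewrite -(expn0 p) ltn_exp2l. Qed.

Lemma expqB (x y : F) : (x - y) ^+ q = x ^+ q - y ^+ q.
Proof. by apply: (addIr (y ^+ q)); rewrite -(expfD_pchar charFp) !subrK. Qed.

Lemma fixed_subfieldB x y :
  x \in fixed_subfield -> y \in fixed_subfield -> x - y \in fixed_subfield.
Proof. by rewrite !inE expqB => /eqP -> /eqP ->. Qed.

Lemma fixed_subfield0 : 0 \in fixed_subfield.
Proof. by rewrite inE expr0n gtn_eqF // ltnW. Qed.

Definition artin_schreier_fiber a : {set F} := [set y | a == y ^+ q - y].

Lemma card_artin_schreier_fiber y :
  #|artin_schreier_fiber (y ^+ q - y)| = #|fixed_subfield|.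
Proof.
rewrite -[RHS](card_imset _ (addIr y)); apply: eq_card => z; rewrite inE.
apply/eqP/imsetP => [yz|[c]].
  by exists (z - y); rewrite ?subrK // inE expqB subr_eq -addrA addrC -subr_eq [- y + _]addrC -yz.
by rewrite inE => /eqP cq ->; rewrite (expfD_pchar charFp) cq opprD addrACA subrr add0r.
Qed.

Lemma trace_artin_schreier (y : F) : trq (y ^+ q - y) = 0.
Proof.
by rewrite (field_traceB charFp) field_trace_exp ?subrr // -cardF expf_card.
Qed.

(** Both claims come from one count. The fibres of y -> y^q - y have the size of the fixed subfield,
    at most q, and the image lies in the kernel of the trace, of size at most q^(m - 1). As #|F| =
    q^m, all these bounds are equalities. *)
Lemma artin_schreier_card : #|fixed_subfield| = q /\
  forall a : F, trq a = 0 -> exists y, a = y ^+ q - y.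
Proof.
pose I := [set y ^+ q - y | y : F]; pose T := [set a : F | trq a == 0].
have IT : I \subset T.
  by apply/subsetP=> _ /imsetP[y _ ->]; rewrite inE trace_artin_schreier.
have cardIK : #|F| = (#|I| * #|fixed_subfield|)%N.
  rewrite -[LHS]sum1_card (partition_big (fun y => y ^+ q - y) (mem I)) /=.
    rewrite -sum_nat_const; apply: eq_bigr => _ /imsetP[y _ ->].
    rewrite sum1_card -(card_artin_schreier_fiber y); apply: eq_card => z.
    by rewrite !inE eq_sym.
  by move=> y _; apply: imset_f.
have cK : (#|fixed_subfield| <= q)%N.
  have sP : size ('X^q - 'X : {poly F}) = q.+1.
    by rewrite size_polyDl size_polyXn // size_polyN size_polyX ltnS.
  have P0 : 'X^q - 'X != 0 :> {poly F} by rewrite -size_poly_eq0 sP.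
  have := card_roots_lt P0; rewrite sP ltnS; apply: leq_trans.
  by apply: subset_leq_card; apply/subsetP => x; rewrite !inE /root !hornerE subr_eq0.
have cT : (#|T| <= q ^ m.-1)%N.
  pose P : {poly F} := \sum_(i < m) 'X^(q ^ i).
  have DP : P = 'X^(q ^ m.-1) + \sum_(i < m.-1) 'X^(q ^ i).
    by rewrite /P; case: (m) m0 => // m' _; rewrite big_ord_recr addrC.
  have sP : size P = (q ^ m.-1).+1.
    rewrite DP size_polyDl size_polyXn // ltnS.
    apply: (big_ind (fun P : {poly F} => size P <= q ^ m.-1)%N); first by rewrite size_poly0.
      by move=> u v su sv; rewrite (leq_trans (size_polyD _ _)) // geq_max su.
    by move=> i _; rewrite size_polyXn ltn_exp2l.
  have P0 : P != 0 by rewrite -size_poly_eq0 sP.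
  have := card_roots_lt P0; rewrite sP ltnS; apply: leq_trans.
  apply: subset_leq_card; apply/subsetP => x; rewrite !inE /root horner_sum => /eqP tx.
  by rewrite -[X in _ == X]tx; apply/eqP/eq_bigr => i _; rewrite hornerXn.
have cI : (#|I| <= q ^ m.-1)%N by rewrite (leq_trans (subset_leq_card IT)).
have qm : (q ^ m = q ^ m.-1 * q)%N by rewrite -expnSr prednK.
have qm0 : (0 < q ^ m.-1)%N by rewrite expn_gt0 ltnW.
move: cardIK; rewrite cardF qm => cardIK; split.
  apply/eqP; rewrite eqn_leq cK -(leq_pmul2l qm0) cardIK.
  by rewrite leq_mul2r cI orbT.
have I_ge : (q ^ m.-1 <= #|I|)%N.
  by rewrite -(leq_pmul2r (ltnW q1)) cardIK leq_mul2l cK orbT.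
move=> a /eqP tra; have /eqP EIT : I == T by rewrite eqEcard IT (leq_trans cT).
have : a \in I by rewrite EIT inE.
by case/imsetP => y _; exists y.
Qed.

Lemma card_artin_schreier_fiber_trace (a : F) :
  #|artin_schreier_fiber a| = if trq a == 0 then q else 0%N.
Proof.
have [cK surj] := artin_schreier_card.
case: eqP => [/surj[y ->]|tra]; first by rewrite card_artin_schreier_fiber.
by apply: eq_card0 => y; rewrite inE; apply/eqP => ay; rewrite ay trace_artin_schreier in tra.
Qed.

(** Transitivity of the trace, written as a linearized polynomial in c so that its zeros on F_q can
    be counted. *)
Lemma absolute_trace_tower (c a : F) : c \in fixed_subfield ->
  field_trace (e * m) p (c * a) = \sum_(i < e) trq a ^+ (p ^ i) * c ^+ (p ^ i).
Proof.
rewrite inE => /eqP cq; have cqj j : c ^+ (q ^ j) = c.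
  by elim: j => [|j IH]; rewrite ?expn0 ?expr1 // expnS exprM cq.
rewrite /field_trace (sum_ord_mul (fun i => (c * a) ^+ (p ^ i))) exchange_big /=; apply: eq_bigr => i _.
rewrite (sum_expf_pchar charFp) mulr_suml; apply: eq_bigr => j _.
by rewrite expnD expnM exprM exprMn cqj exprMn mulrC.
Qed.

(** If the trace of a onto F_q is nonzero, c -> Tr(c a) is a polynomial of degree less than q with
    nonzero linear coefficient, so it does not vanish on all of F_q. The sum then runs over the
    subgroup F_q a, on which Tr is not 0. *)
Lemma sum_add_char_fixed_subfield a :
  \sum_(c in fixed_subfield) add_char (e * m) O (c * a) = #|artin_schreier_fiber a|%:R.
Proof.
have cF : #|F| = (p ^ (e * m))%N by rewrite expnM.
have [cK _] := artin_schreier_card; rewrite card_artin_schreier_fiber_trace.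
case: eqP => [tra|tra].
  rewrite -cK -sumr_const; apply: eq_bigr => c Kc.
  rewrite (add_char_trace0 O charFp cF) // absolute_trace_tower // tra big1 // => i _.
  by rewrite expr0n expn_eq0 gtn_eqF ?(ltnW p1) //= mul0r.
have a0 : a != 0.
  by apply/eqP => a0; apply: tra; rewrite a0 field_trace0.
have [c Kc trc] : exists2 c, c \in fixed_subfield & field_trace (e * m) p (c * a) != 0.
  apply/exists_inP; apply: contra_notT tra => /exists_inPn H.
  apply: (@linearized_poly_eq0 _ _ charFp (fun i => trq a ^+ (p ^ i)) e.-1 fixed_subfield).
    by rewrite cK prednK.
  by move=> x Kx; rewrite prednK // -absolute_trace_tower //; apply/eqP/negPn/H.
pose K' := [set c * a | c in fixed_subfield].
transitivity (\sum_(x in K') add_char (e * m) O x).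
  by rewrite big_imset //= => x y _ _ /(mulIf a0).
apply: (@sum_add_char_subgroup p (e * m) L F O charFp cF K' (c * a)).
- by apply/imsetP; exists 0; rewrite ?fixed_subfield0 ?mul0r.
- move=> _ _ /imsetP[x Kx ->] /imsetP[y Ky ->]; apply/imsetP.
  by exists (x - y); rewrite ?fixed_subfieldB ?mulrBl.
- exact: imset_f.
exact/eqP.
Qed.

Lemma Ncount_add_char k (f : {mpoly F[k]}) : (Ncount q f)%:R =
  \sum_(x : {ffun 'I_k -> F}) \sum_(c in fixed_subfield) add_char (e * m) O (c * f.@[x]).
Proof.
under eq_bigr => x _ do rewrite sum_add_char_fixed_subfield.
rewrite -natr_sum /Ncount -sum1_card (partition_big fst xpredT) //=; congr (_%:R).
apply: eq_bigr => x _; rewrite sum1_card.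
rewrite -[RHS](card_imset (artin_schreier_fiber f.@[x]) (f := pair x)); last by move=> y z [].
apply: eq_card => -[x' y]; rewrite unfold_in inE /=; apply/andP/imsetP => [[xy /eqP <-]|[z]].
  by exists y => //; rewrite inE.
by rewrite inE => fz [-> ->].
Qed.

End ArtinSchreier.

(* [power_sum q n] is the sum of the n-th powers of the Teichmueller lifts of
   the elements of the field with q elements, where 0 ^+ 0 = 1. *)
Definition power_sum q n := if n == 0 then q else if q - 1 %| n then q - 1 else 0.

(** * Expansion of the point count *)

Section PointCount.
Local Open Scope ring_scope.
Variables (p e m L : nat) (F : finFieldType) (O : teichmuller_ring p L F).
Hypotheses (charFp : p \in [pchar F]) (cardF : #|F| = ((p ^ e) ^ m)%N).
Hypotheses (e0 : (0 < e)%N) (m0 : (0 < m)%N).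
Local Notation q := (p ^ e)%N.
Local Notation Q := #|F|.
Local Notation E := (e * m)%N.
Local Notation rho := (residue O).
Local Notation tau := (teich O).
Local Notation pi := (unif O).
Hypothesis EL : (E * (p - 1) < L)%N.

Let p_pr : prime p := pcharf_prime charFp.
Let p1 : (1 < p)%N := prime_gt1 p_pr.
Let q1 : (1 < q)%N. Proof. by rewrite -(expn0 p) ltn_exp2l. Qed.
Let cardFE : Q = (p ^ E)%N. Proof. by rewrite expnM. Qed.

(** The coefficient of the product of the tau(a_s)^(r_s) in the point count. [S] indexes monomials
    and [T] gives their exponents; the first power sum comes from the scalar in F_q, the others from
    the coordinates. *)
Definition count_coef (c : nat -> O) (S : finType) k (T : S -> 'I_k -> nat)
    (r : {ffun S -> 'I_Q}) : O :=
  (\prod_s c (r s)) * (power_sum q (\sum_s r s)%N)%:R *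
  \prod_(i < k) (power_sum Q (\sum_s r s * T s i)%N)%:R.

Lemma teich_prod I (s : seq I) (P : pred I) (f : I -> F) :
  tau (\prod_(i <- s | P i) f i) = \prod_(i <- s | P i) tau (f i).
Proof. by apply: (big_morph tau (teichM O) (teich1 O)). Qed.

(** As psi is additive, psi(b f(x)) is a product over the monomials. Expanding each factor in powers
    of tau and distributing, the sums over b and over each x_i separate. The coefficients [c] are
    fixed before the monomials. *)
Lemma point_count : exists c : nat -> O,
  (forall r, (r < Q)%N -> val_eq (c r) (digsum p r)) /\
  forall (S : finType) k (T : S -> 'I_k -> nat) (a : S -> F) (f : {mpoly F[k]}),
    (forall x : 'I_k -> F, f.@[x] = \sum_s a s * \prod_(i < k) x i ^+ T s i) ->
    (Ncount q f)%:R = \sum_r count_coef c T r * \prod_s tau (a s) ^+ r s.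
Proof.
have E0 : (0 < E)%N by rewrite muln_gt0 e0.
have [c [psiE cv]] := add_char_expansion O charFp cardFE E0 EL.
exists c; split=> // S k T a f fE.
rewrite (Ncount_add_char O charFp cardF e0 m0).
have psif (x : {ffun 'I_k -> F}) b : add_char E O (b * f.@[x]) =
    \sum_(r : {ffun S -> 'I_Q}) (\prod_s c (r s)) * (\prod_s tau (a s) ^+ r s) *
      tau b ^+ (\sum_s r s)%N * \prod_(i < k) tau (x i) ^+ (\sum_s r s * T s i)%N.
  have -> : add_char E O (b * f.@[x]) =
      \prod_s add_char E O (b * (a s * \prod_(i < k) x i ^+ T s i)).
    rewrite fE mulr_sumr; apply: (big_morph _ _ (add_char0 O charFp cardFE)).
    exact: add_charD.
  under eq_bigr => s _ do rewrite psiE.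
  rewrite bigA_distr_bigA /=; apply: eq_bigr => r _.
  rewrite big_split /= -!mulrA; congr (_ * _).
  under eq_bigr => s _ do rewrite !teichM !exprMn teich_prod -prodrXl.
  rewrite !big_split /= prodrXr mulrCA; congr (_ * (_ * _)).
  rewrite exchange_big /=; apply: eq_bigr => i _.
  rewrite -prodrXr; apply: eq_bigr => s _.
  by rewrite teichX -exprM mulnC.
under eq_bigr => x _ do under eq_bigr => b _ do rewrite psif.
under eq_bigr => x _ do rewrite exchange_big /=.
rewrite exchange_big /=; apply: eq_bigr => r _.
have [cK _] := artin_schreier_card charFp cardF e0 m0.
have sumK n : \sum_(b in fixed_subfield p e F) tau b ^+ n = (power_sum q n)%:R.
  by apply: sum_teich_subfield => // b; rewrite inE.
rewrite (eq_bigr (fun x : {ffun 'I_k -> F} => (\prod_s c (r s)) * (\prod_s tau (a s) ^+ r s) *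
    (power_sum q (\sum_s r s)%N)%:R * \prod_(i < k) tau (x i) ^+ (\sum_s r s * T s i)%N)); last first.
  by move=> x _; rewrite -mulr_suml -mulr_sumr sumK.
rewrite /count_coef.
have -> : \prod_(i < k) (power_sum Q (\sum_s r s * T s i)%N)%:R =
    \sum_(x : {ffun 'I_k -> F}) \prod_(i < k) tau (x i) ^+ (\sum_s r s * T s i)%N.
  rewrite -(bigA_distr_bigA (fun i y => tau y ^+ (\sum_s r s * T s i)%N)).
  by apply: eq_bigr => i _; rewrite sum_teich.
by rewrite -mulr_sumr [RHS]mulrAC; congr (_ * _); rewrite mulrAC.
Qed.

Lemma val_eq_prod (I : Type) (s : seq I) (P : pred I) (f : I -> O) g :
  (forall i, val_eq (f i) (g i)) ->
  val_eq (\prod_(i <- s | P i) f i) (\sum_(i <- s | P i) g i)%N.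
Proof.
move=> fg; apply: (big_ind2 (fun x n => val_eq x n)) => // [|x a y b]; last exact: val_eqM.
by exists 1; rewrite ?mul1r // rmorph1; apply/eqP/oner_neq0.
Qed.

Lemma val_ge_prod (I : Type) (s : seq I) (P : pred I) (f : I -> O) g :
  (forall i, val_ge (f i) (g i)) ->
  val_ge (\prod_(i <- s | P i) f i) (\sum_(i <- s | P i) g i)%N.
Proof.
move=> fg; apply: (big_ind2 (fun x n => val_ge x n)) => // [|x a y b]; last exact: val_geM.
by exists 1; rewrite ?mul1r.
Qed.

Lemma val_eq_power_sum N d n : N = (p ^ d)%N -> (0 < d)%N -> (0 < n)%N -> (N - 1 %| n)%N ->
  val_eq ((power_sum N n)%:R : O) 0.
Proof.
move=> DN d0 n0 dn; exists (N - 1)%:R; last by rewrite mul1r /power_sum gtn_eqF // dn.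
rewrite rmorph_nat DN natrB ?expn_gt0 ?(ltnW p1) // natrX (pcharf0 charFp).
by rewrite expr0n gtn_eqF // sub0r; apply/eqP; rewrite oppr_eq0 oner_neq0.
Qed.

Variables (c : nat -> O) (S : finType) (k : nat) (T : S -> 'I_k -> nat).
Hypothesis cv : forall r, (r < Q)%N -> val_eq (c r) (digsum p r).
Variable r : {ffun S -> 'I_Q}.
Local Notation n := (fun i => \sum_s r s * T s i)%N.

Lemma val_count_coef : (0 < \sum_s r s)%N -> (q - 1 %| \sum_s r s)%N ->
    (forall i, 0 < n i /\ (Q - 1 %| n i))%N ->
  val_eq (count_coef c T r) (\sum_s digsum p (r s))%N.
Proof.
move=> r0 qr Qn; rewrite -[(\sum_s _)%N]addn0 -[(_ + 0)%N]addn0.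
apply: val_eqM; first apply: val_eqM.
- by apply: val_eq_prod => s; apply: cv.
- exact: (val_eq_power_sum (erefl q)).
have v0 i : val_eq ((power_sum Q (n i))%:R : O) ((fun=> 0%N) i).
  have [n0 ndvd] := Qn i; apply: (val_eq_power_sum cardFE) => //.
  by rewrite muln_gt0 e0.
by have := val_eq_prod (index_enum 'I_k) predT v0; rewrite big1_eq.
Qed.

(* Each vanishing exponent [n i] contributes a factor [Q]. *)
Lemma val_ge_count_coef B :
    ((q - 1 %| \sum_s r s)%N -> (forall i, Q - 1 %| n i)%N ->
      (B <= \sum_s digsum p (r s) + #|[set i | n i == 0]| * (E * (p - 1)))%N) ->
  val_ge (count_coef c T r) B.
Proof.
have vz x : x = 0 -> val_ge x B by move=> ->; exists 0; rewrite mulr0.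
have [qr|nqr] := boolP (q - 1 %| \sum_s r s)%N; last first.
  move=> _; apply: vz; rewrite /count_coef /power_sum (negPf nqr) ifF ?mulr0 ?mul0r //.
  by apply: contraNF nqr => /eqP ->; rewrite dvdn0.
have [/forallP Qn|] := boolP [forall i, Q - 1 %| n i]%N; last first.
  move/forallPn => [i nQi] _; apply: vz; rewrite /count_coef (bigD1 i) //=.
  rewrite {2}/power_sum (negPf nQi) ifF ?mul0r ?mulr0 //.
  by apply: contraNF nQi => /eqP ->; rewrite dvdn0.
move=> /(_ isT Qn) le; apply: val_ge_le le _; rewrite -[(\sum_s _)%N]addn0.
apply: val_geM; first apply: val_geM.
- by apply: val_ge_prod => s; apply/val_geW/cv.
- by eexists; rewrite mul1r.
have -> : (#|[set i | n i == 0]| * (E * (p - 1)) =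
    \sum_(i < k) if n i == 0 then E * (p - 1) else 0)%N.
  by rewrite -sum_nat_const big_mkcond; apply: eq_bigr => i _; rewrite inE.
have v i : val_ge ((power_sum Q (n i))%:R : O) (if n i == 0 then E * (p - 1) else 0)%N.
  rewrite /power_sum; case: eqP => _; last by eexists; rewrite mul1r.
  by apply/val_geW/(val_natrQ O charFp cardFE).
exact: val_ge_prod.
Qed.

End PointCount.

(** * Moving exponent matrices into the box *)

Section BoxReduction.
Variables (S : finType) (k N : nat) (w : S -> nat).
Hypotheses (N0 : 0 < N) (w0 : forall s, 0 < w s).
Implicit Type T : S -> 'I_k -> nat.

Let feas T :=
  forall i, 0 < \sum_s w s * T s i /\ (N %| \sum_s w s * T s i).
Let nonpure T := #|[set i | [exists s, ~~ (N %| T s i)]]|.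
Let excess T := \sum_s \sum_i (T s i - N).

Let pos_col T s i : 0 < T s i -> 0 < \sum_s w s * T s i.
Proof. by move=> T0; rewrite (bigD1 s) //= addn_gt0 muln_gt0 w0 T0. Qed.

Let shift_chunk T s i b t j :=
  if t == s then (if j == i then T s i - N else if j == b then T s b + N else T s j)
  else T t j.

(** Column i absorbs column b in all rows, then hands back a single N in row s, so that column b
    becomes divisible by N while its weighted sum stays positive. *)
Let merge_columns T s i b t j :=
  if j == i then T t i + T t b - (t == s) * N
  else if j == b then (t == s) * N else T t j.

Let row2 (f g : 'I_k -> nat) i b : i != b -> f i + f b = g i + g b ->
  (forall j, j != i -> j != b -> f j = g j) -> \sum_j f j = \sum_j g j.
Proof.
move=> ib fg H; rewrite (bigD1 i) //= (bigD1 b) 1?eq_sym //= addnA fg -addnA.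
rewrite [RHS](bigD1 i) //= [in RHS](bigD1 b) 1?eq_sym //=; congr (_ + (_ + _)).
by apply: eq_bigr => j /andP[ji jb]; apply: H.
Qed.

Let col_update (T T' : S -> 'I_k -> nat) s j x y :
  (forall t, t != s -> T' t j = T t j) -> T' s j + x = T s j + y ->
  \sum_t w t * T' t j + w s * x = \sum_t w t * T t j + w s * y.
Proof.
move=> H Hs; rewrite (bigD1 s) //= [in RHS](bigD1 s) //= addnAC -mulnDr Hs.
rewrite mulnDr addnAC; congr (_ + _ + _).
by apply: eq_bigr => t ts; rewrite H.
Qed.

(** Residues modulo N do not change. The excess at b grows from 0 to [T s b]. At i it drops by N if
    [N + N <= T s i], which exceeds [T s b]; if [T s b] is 0, any drop suffices. *)
Let shift_chunk_step T s i b : i != b -> N < T s i -> T s b < N ->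
    (N + N <= T s i) || (T s b == 0) -> feas T ->
  let T' := shift_chunk T s i b in
  [/\ forall t, \sum_j T' t j = \sum_j T t j, feas T', nonpure T' = nonpure T
    & excess T' < excess T].
Proof.
move=> ib Ti Tb cas fT T'.
have bi : (b == i) = false by rewrite eq_sym (negPf ib).
have Tsi : T' s i = T s i - N by rewrite /T' /shift_chunk !eqxx.
have Tsb : T' s b = T s b + N by rewrite /T' /shift_chunk eqxx bi eqxx.
have Tj t j : j != i -> j != b -> T' t j = T t j.
  by rewrite /T' /shift_chunk => /negPf-> /negPf->; case: eqP => // ->.
have Tt t j : t != s -> T' t j = T t j by rewrite /T' /shift_chunk => /negPf->.
have dvdT t j : (N %| T' t j) = (N %| T t j).
  have [->|/Tt->//] := eqVneq t s.
  have [->|ji] := eqVneq j i.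
    by rewrite Tsi -(dvdn_addl _ (dvdnn N)) subnK // ltnW.
  have [->|jb] := eqVneq j b; last by rewrite Tj.
  by rewrite Tsb dvdn_addl.
split.
- move=> t; have [->|ts] := eqVneq t s; last by apply: eq_bigr => j _; rewrite Tt.
  apply: (row2 ib); first by rewrite Tsi Tsb addnCA subnK ?(ltnW Ti) // addnC.
  exact: Tj.
- move=> j; have [p0 dv] := fT j.
  have [->|ji] := eqVneq j i.
    split; first by apply: (@pos_col _ s); rewrite Tsi subn_gt0.
    have [_ dvi] := fT i; have E := @col_update T T' s i N 0 (fun t => Tt t i).
    have {}E := E (etrans (congr1 (addn^~ N) Tsi) (etrans (subnK (ltnW Ti)) (esym (addn0 _)))).
    by rewrite -(dvdn_addl _ (dvdn_mull (w s) (dvdnn N))) E muln0 addn0.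
  have [->|jb] := eqVneq j b.
    split; first by apply: (@pos_col _ s); rewrite Tsb addn_gt0 N0 orbT.
    have [_ dvb] := fT b; have E := @col_update T T' s b 0 N (fun t => Tt t b).
    have {}E := E (etrans (addn0 _) Tsb).
    by rewrite muln0 addn0 in E; rewrite E dvdn_add // dvdn_mull.
  by under eq_bigr => t _ do rewrite Tj //.
- rewrite /nonpure; apply: eq_card => j; rewrite !inE.
  by apply: eq_existsb => t; rewrite dvdT.
rewrite /excess (bigD1 s) //= [X in _ < X](bigD1 s) //=.
rewrite (eq_bigr (fun t => \sum_i0 (T t i0 - N))) => [|t ts]; last first.
  by apply: eq_bigr => j _; rewrite Tt.
rewrite ltn_add2r (bigD1 i) //= (bigD1 b) 1?eq_sym //= [X in _ < X](bigD1 i) //=.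
rewrite [X in _ < _ + X](bigD1 b) 1?eq_sym //= Tsi Tsb.
rewrite (eq_bigr (fun j => T s j - N)) => [|j /andP[ji jb]]; last by rewrite Tj.
by rewrite !addnA ltn_add2r; case/orP: cas => [|/eqP]; lia.
Qed.

(** Column b, not divisible by N because of [T s b], becomes divisible. Column i may remain
    indivisible, but it was so before because of [T s i]; hence the number of such columns drops. *)
Let merge_columns_step T s i b : i != b -> N < T s i < N + N -> 0 < T s b < N ->
    feas T ->
  let T' := merge_columns T s i b in
  [/\ forall t, \sum_j T' t j = \sum_j T t j, feas T' & nonpure T' < nonpure T].
Proof.
move=> ib /andP[Ti Ti2] /andP[Tb0 Tb] fT T'.
have bi : (b == i) = false by rewrite eq_sym (negPf ib).
have Tib t : T' t i = T t i + T t b - (t == s) * N by rewrite /T' /merge_columns eqxx.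
have Tbb t : T' t b = (t == s) * N by rewrite /T' /merge_columns bi eqxx.
have Tj t j : j != i -> j != b -> T' t j = T t j.
  by rewrite /T' /merge_columns => /negPf-> /negPf->.
have le_ib t : (t == s) * N <= T t i + T t b by case: eqP => [->|//]; lia.
split.
- move=> t; apply: (row2 ib); last exact: Tj.
  by rewrite Tib Tbb subnK.
- move=> j; have [->|ji] := eqVneq j i.
    split; first by apply: (@pos_col _ s); rewrite Tib eqxx; lia.
    have [_ dvi] := fT i; have [_ dvb] := fT b.
    rewrite -(dvdn_addl _ (dvdn_mull (w s) (dvdnn N))).
    suff -> : \sum_t w t * T' t i + w s * N = \sum_t w t * T t i + \sum_t w t * T t b.
      by rewrite dvdn_add.
    have -> : w s * N = \sum_t w t * ((t == s) * N).
      by rewrite (bigD1 s) //= eqxx mul1n big1 ?addn0 // => t /negPf->; rewrite mul0n muln0.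
    rewrite -!big_split; apply: eq_bigr => t _ /=.
    by rewrite -!mulnDr Tib subnK.
  have [->|jb] := eqVneq j b; last by under eq_bigr => t _ do rewrite Tj //; exact: fT.
  split; first by apply: (@pos_col _ s); rewrite Tbb eqxx mul1n.
  by apply: dvdn_sum => t _; rewrite Tbb !dvdn_mull.
apply: proper_card; apply/properP; split; last first.
  exists b; rewrite inE; first by apply/existsP; exists s; rewrite gtnNdvd.
  by apply/negP => /existsP[t]; rewrite Tbb dvdn_mull.
apply/subsetP => j; rewrite !inE.
have [-> _|ji] := eqVneq j i; first by apply/existsP; exists s; rewrite ndvdn_between.
have [->|jb] := eqVneq j b; first by case/existsP=> t; rewrite Tbb dvdn_mull.
by case/existsP=> t; rewrite Tj // => dt; apply/existsP; exists t.
Qed.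

(* Lexicographic descent on (number of columns with an entry not divisible by
   [N], total excess over [N]): an excess entry either gives a chunk [N] to
   another column, or absorbs that whole column, which becomes a single chunk. *)
Lemma box_reduction T : (forall s, \sum_i T s i <= k * N) -> feas T ->
  exists T', [/\ forall s, \sum_i T' s i = \sum_i T s i,
                 forall s i, T' s i <= N & feas T'].
Proof.
pose W T := \sum_s \sum_i T s i.
(* The total [W] depends on the row sums only, hence is invariant, and bounds the excess; so this
   number encodes the lexicographic order. *)
have [n] := ubnP (nonpure T * (W T).+1 + excess T).
elim: n T => // n IH T meas rowT fT.
have [/forallP box|] := boolP [forall s, [forall i, T s i <= N]].
  by exists T; split=> // s i; have /forallP := box s; apply.
case/forallPn => s /forallPn[i]; rewrite -ltnNge => Ti.
have [b Tb] : exists b, T s b < N.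
  apply/existsP; apply: contraLR (rowT s) => /existsPn ge; rewrite -ltnNge.
  rewrite -{1}(card_ord k) -sum_nat_const (bigD1 i) //= [X in _ < X](bigD1 i) //=.
  rewrite -addSn leq_add // leq_sum // => j _.
  by rewrite leqNgt ge.
have ib : i != b by apply/eqP => ib; rewrite ib in Ti; lia.
have next T' : (forall t, \sum_j T' t j = \sum_j T t j) -> feas T' ->
    nonpure T' * (W T').+1 + excess T' < nonpure T * (W T).+1 + excess T ->
    exists T'', [/\ forall s, \sum_i T'' s i = \sum_i T s i,
                 forall s i, T'' s i <= N & feas T''].
  move=> row' f' lt; have [||T'' [r1 r2 r3]] := IH T' _ _ f'.
  - exact: leq_trans lt _.
  - by move=> t; rewrite row'.
  by exists T''; split=> // t; rewrite r1 row'.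
have WE T' : (forall t, \sum_j T' t j = \sum_j T t j) -> W T' = W T.
  by move=> row'; apply: eq_bigr => t _; apply: row'.
have [cas|] := boolP ((N + N <= T s i) || (T s b == 0)).
  have [r f np ex] := @shift_chunk_step T s i b ib Ti Tb cas fT.
  by apply: (next _ r f); rewrite np (WE _ r) ltn_add2l.
rewrite negb_or -ltnNge -lt0n => /andP[Ti2 Tb0].
have [||r f np] := @merge_columns_step T s i b ib _ _ fT; rewrite ?Ti ?Tb0 //.
apply: (next _ r f); rewrite (WE _ r).
set T' := merge_columns _ _ _ _ in r f np *.
have : excess T' <= W T by rewrite -(WE _ r) leq_sum // => t _; rewrite leq_sum // => j _; rewrite leq_subr.
by nia.
Qed.

End BoxReduction.

Lemma modn_sum_eq d I (r : seq I) (P : pred I) (f g : I -> nat) :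
  (forall i, P i -> f i = g i %[mod d]) ->
  \sum_(i <- r | P i) f i = \sum_(i <- r | P i) g i %[mod d].
Proof.
move=> fg; rewrite -modn_summ -[RHS]modn_summ; congr (_ %% d).
exact: eq_bigr.
Qed.

Lemma dvdn_exp_pred a b : 0 < a -> a - 1 %| a ^ b - 1.
Proof. by move=> a0; rewrite -{2}(exp1n b) subn_exp dvdn_mulr. Qed.

(** * From weighted monomials to feasible solutions *)

Section Feasible.
Variables (p e m k : nat) (D : pred nat).
Hypotheses (p_pr : prime p) (e0 : 0 < e) (m0 : 0 < m).
Local Notation q := (p ^ e).
Local Notation Q := (q ^ m).
Hypothesis DQ : forall d, D d -> d <= k * (Q - 1).
Let p1 : 1 < p := prime_gt1 p_pr.
Let QE : Q = p ^ (e * m). Proof. by rewrite expnM. Qed.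
Let Q1 : 1 < Q. Proof. by rewrite QE -(expn0 p) ltn_exp2l // muln_gt0 e0. Qed.
Let qQ : q - 1 %| Q - 1. Proof. by rewrite dvdn_exp_pred // expn_gt0 ltnW. Qed.

Let digsum_cycle x : digsum p (cycle_rep (Q - 1) x) <= digsum p x.
Proof. by rewrite QE; apply: digsum_cycle_rep; rewrite // muln_gt0 e0. Qed.
Let digsumQ1 : digsum p (Q - 1) = e * m * (p - 1).
Proof. by rewrite QE digsum_pred_expn. Qed.

(** Once the exponents are in the box, several items may share the same vector t: their weights are
    added and brought back to [0, Q - 1] by [cycle_rep]. Neither operation raises the digit sum, and
    both respect the congruences and positivity. *)
Lemma feasible_of_items (S : finType) (w : S -> nat) (T : S -> 'I_k -> nat) :
    (forall s, 0 < w s) -> (forall s, D (\sum_i T s i)) -> q - 1 %| \sum_s w s ->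
    (forall i, 0 < \sum_s w s * T s i /\ (Q - 1 %| \sum_s w s * T s i)) ->
  exists r, feasible q Q k D r /\
    \sum_(t | inTD (Q := Q) D t) digsum p (r t) <= \sum_s digsum p (w s).
Proof.
move=> w0 DT wq fT; have N0 : 0 < Q - 1 by rewrite subn_gt0.
have [T' [rowT' boxT' fT']] := box_reduction N0 w0 (fun s => DQ (DT s)) fT.
have ltT s i : T' s i < Q by rewrite (leq_ltn_trans (boxT' s i)) //; lia.
pose t s : {ffun 'I_k -> 'I_Q} := [ffun i => Ordinal (ltT s i)].
have tT s i : t s i = T' s i :> nat by rewrite ffunE.
have tD s : inTD D (t s).
  by rewrite /inTD (eq_bigr (T' s)) ?rowT' // => i _; rewrite tT.
pose R u := \sum_(s | t s == u) w s.
have sumR (g : {ffun 'I_k -> 'I_Q} -> nat) :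
    \sum_(u | inTD D u) R u * g u = \sum_s w s * g (t s).
  rewrite [RHS](partition_big t (fun u => inTD D u)) //=; apply: eq_bigr => u _.
  by rewrite big_distrl /=; apply: eq_bigr => s /eqP ->.
pose r u := cycle_rep (Q - 1) (R u).
have sumr (g : {ffun 'I_k -> 'I_Q} -> nat) :
    \sum_(u | inTD D u) r u * g u = \sum_s w s * g (t s) %[mod Q - 1].
  rewrite -sumR; apply: modn_sum_eq => u _.
  by rewrite -modnMml cycle_rep_mod modnMml.
exists r; split.
  split.
  - by move=> u _; apply: cycle_rep_le.
  - rewrite (eq_bigr (fun u => r u * 1)) => [|u _]; last by rewrite muln1.
    rewrite /dvdn -(modn_dvdm _ qQ) sumr modn_dvdm //.
    by under eq_bigr => s _ do rewrite muln1.
  move=> i; have DE : \sum_s w s * t s i = \sum_s w s * T' s i.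
    by apply: eq_bigr => s _; rewrite tT.
  have [pos dv] := fT' i; split; last by rewrite /dvdn (sumr (fun u => u i)) DE.
  move: pos; rewrite -DE -(sumR (fun u => u i)) !lt0n; apply: contraNN.
  rewrite !sum_nat_eq0 => /forall_inP H; apply/forall_inP => u uD.
  by have := H u uD; rewrite !muln_eq0 cycle_rep_eq0.
have le1 u : digsum p (r u) <= \sum_(s | t s == u) digsum p (w s).
  exact: leq_trans (digsum_cycle (R u)) (digsum_sum p1 _ _ _).
rewrite [leqRHS](partition_big t (fun u => inTD D u)) //=.
by apply: leq_sum => u _; apply: le1.
Qed.

(* A coordinate with vanishing exponent sum is filled with one extra item,
   the monomial [x_i ^ d] with weight [Q - 1], of digit sum [e * m * (p - 1)]. *)
Lemma feasible_of_weights (S : finType) (r : S -> nat) (T : S -> 'I_k -> nat) d :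
    0 < d -> D d -> (forall s, D (\sum_i T s i)) -> q - 1 %| \sum_s r s ->
    (forall i, Q - 1 %| \sum_s r s * T s i) ->
  exists r', feasible q Q k D r' /\
    \sum_(t | inTD (Q := Q) D t) digsum p (r' t) <=
    \sum_s digsum p (r s) + #|[set i | \sum_s r s * T s i == 0]| * (e * m * (p - 1)).
Proof.
move=> d0 Dd DT rq nQ; pose n i := \sum_s r s * T s i.
(* Items of weight 0 are discarded, since the box reduction requires positive weights. *)
pose A : pred (S + 'I_k) := fun x =>
  match x with inl s => 0 < r s | inr i => n i == 0 end.
pose W (x : S + 'I_k) := match x with inl s => r s | inr i => Q - 1 end.
pose U (x : S + 'I_k) (j : 'I_k) :=
  match x with inl s => T s j | inr i => (j == i) * d end.
have sumA (f : S + 'I_k -> nat) : \sum_(x : {x in A}) f (val x) =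
    \sum_(s | 0 < r s) f (inl s) + \sum_(i | n i == 0) f (inr i).
  by rewrite -big_sub big_sumType.
have [|||j|r' [fr' le]] := @feasible_of_items {x in A} (W \o val) (U \o val).
- by case=> -[s|i] /=; rewrite unfold_in //= subn_gt0.
- case=> -[s|i] _ /=; first exact: DT.
  rewrite (bigD1 i) //= eqxx mul1n big1 ?addn0 // => j /negPf ji.
  by rewrite ji.
- rewrite (sumA W) /= dvdn_add //; last by apply: dvdn_sum.
  by move: rq; rewrite (bigID (fun s => 0 < r s)) /= [X in _ + X]big1 ?addn0 // => s; lia.
- have -> : \sum_(x : {x in A}) (W \o val) x * (U \o val) x j =
      n j + (n j == 0) * ((Q - 1) * d).
    rewrite (sumA (fun x => W x * U x j)) /=; congr (_ + _).
      by rewrite /n [RHS](bigID (fun s => 0 < r s)) /= [X in _ + X]big1 ?addn0 // => s; lia.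
    have [nj|nj] := eqVneq (n j) 0.
      rewrite (bigD1 j) /= ?nj // eqxx mul1n big1 ?addn0 ?mul1n // => i /andP[_ ij].
      by rewrite eq_sym (negPf ij) muln0.
    rewrite mul0n big1 // => i ni; rewrite (_ : j == i = false) ?muln0 //.
    by apply: contraNF nj => /eqP ->.
  split; last by apply: dvdn_add; rewrite ?nQ // dvdn_mull ?dvdn_mulr.
  by have [->|] := posnP (n j); [rewrite mul1n muln_gt0 subn_gt0 Q1 | rewrite addn_gt0 => ->].
exists r'; split=> //; apply: leq_trans le _.
rewrite (sumA (fun x => digsum p (W x))) /=; apply: leq_add.
  by rewrite [leqRHS](bigID (fun s => 0 < r s)) leq_addr.
rewrite digsumQ1 sum_nat_const leq_mul2r; apply/orP; right.
by apply/eq_leq/eq_card => i; rewrite inE.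
Qed.

End Feasible.

(** * Polynomials of degree less than #|F| in each variable *)

Section ReducedPolynomial.
Local Open Scope ring_scope.
Variables (p E L : nat) (F : finFieldType) (O : teichmuller_ring p L F).
Hypotheses (charFp : p \in [pchar F]) (cardF : #|F| = (p ^ E)%N) (E0 : (0 < E)%N).
Local Notation Q := #|F|.

Let Q1 : (1 < Q)%N := finNzRing_gt1 F.

Lemma sum_expf n : \sum_(x : F) x ^+ n = (power_sum Q n)%:R.
Proof.
rewrite /power_sum -(rmorph_nat (residue O)) -sum_teich rmorph_sum.
by apply: eq_bigr => x _; rewrite rmorphXn teichK.
Qed.

Lemma natr_cardF : Q%:R = 0 :> F.
Proof. by rewrite -(rmorph_nat (residue O)); apply: residue_natrQ charFp cardF E0. Qed.

(** The basis dual to the powers x^s, s < #|F|, for summation over F. The case r = 0 is separate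
    because - x^(#|F| - 1) pairs to 1 with both x^0 and x^(#|F| - 1). *)
Definition dual_power (r : nat) (x : F) : F :=
  if r == 0%N then (x == 0)%:R else - x ^+ (Q - 1 - r).

Lemma sum_dual_power r s : (r < Q)%N -> (s < Q)%N ->
  \sum_x dual_power r x * x ^+ s = (r == s)%:R.
Proof.
rewrite /dual_power => rQ sQ; have [->|r0] := eqVneq r 0%N.
  rewrite (bigD1 0) //= eqxx mul1r big1 ?addr0 => [|x /negPf ->]; last by rewrite mul0r.
  by rewrite expr0n eq_sym.
under eq_bigr => x _ do rewrite mulNr -exprD.
rewrite sumrN sum_expf /power_sum; have [n0|n0] := eqVneq (Q - 1 - r + s)%N 0%N.
  by rewrite natr_cardF oppr0 (_ : r == s = false) //; lia.
have [<-|rs] := eqVneq r s.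
  by rewrite subnK ?dvdnn ?natrB ?natr_cardF ?sub0r ?opprK //; lia.
have [lt|le] := ltnP s r; first by rewrite gtnNdvd ?oppr0 //; lia.
by rewrite ndvdn_between ?oppr0 //; lia.
Qed.

(** Pairing with the product of the dual powers of exponents [r0 s] extracts the coefficient [c r0]
    from the values. *)
Lemma reduced_poly_neq0 (S : finType) (c : {ffun S -> 'I_Q} -> F) r0 :
  c r0 != 0 -> exists a : {ffun S -> F}, \sum_r c r * \prod_s a s ^+ r s != 0.
Proof.
move=> cr0; apply/existsP; apply: contraNT cr0 => /existsPn c0.
rewrite -[eqbLHS](_ : \sum_(a : {ffun S -> F}) (\prod_s dual_power (r0 s) (a s)) *
                    \sum_r c r * \prod_s a s ^+ r s = _).
  by rewrite big1 // => a _; rewrite (eqP (negPn (c0 a))) mulr0.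
under eq_bigr => a _ do rewrite mulr_sumr.
rewrite exchange_big /= (bigD1 r0) //= [X in _ + X]big1 ?addr0 => [|r rr0].
  under eq_bigr => a _ do rewrite mulrCA -big_split /=.
  rewrite -mulr_sumr -(bigA_distr_bigA (fun s x => dual_power (r0 s) x * x ^+ r0 s)) big1 ?mulr1 //.
  by move=> s _; rewrite sum_dual_power ?ltn_ord // eqxx.
under eq_bigr => a _ do rewrite mulrCA -big_split /=.
rewrite -mulr_sumr -(bigA_distr_bigA (fun s x => dual_power (r0 s) x * x ^+ r s)).
have [s rs] : exists s, r0 s != r s.
  apply/existsP; apply: contraR rr0 => /existsPn H.
  by apply/eqP/ffunP => s; apply/esym/eqP/negPn/H.
by rewrite (bigD1 s) //= sum_dual_power ?ltn_ord // (_ : _ == _ = false) ?mul0r ?mulr0 //; apply: negPf.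
Qed.

End ReducedPolynomial.

(** * Monomials and degree sets *)

Section Polynomials.
Local Open Scope ring_scope.
Variables (k : nat) (R : comNzRingType) (D : pred nat).

Lemma Deg_msupp (f : {mpoly R[k]}) mon : mon \in msupp f -> mdeg mon \in Deg f.
Proof.
move=> fm; have [f0|] := eqVneq (hcomp (mdeg mon) f) 0; last by [].
have := congr1 (mcoeff mon) f0; rewrite mcoeff0 /hcomp big_mkcond raddf_sum.
rewrite (bigD1_seq mon) ?msupp_uniq //= eqxx big1 => [|m' mm'].
  by rewrite addr0 mcoeffZ mcoeffX eqxx mulr1 => /eqP; rewrite -[_ == _]negbK -mcoeff_msupp fm.
by case: ifP => _; rewrite ?mcoeff0 // mcoeffZ mcoeffX (negPf mm') mulr0.
Qed.

Lemma sub_Deg (f : {mpoly R[k]}) :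
  (forall mon, mon \in msupp f -> D (mdeg mon)) -> {subset Deg f <= D}.
Proof.
move=> fD d; rewrite [d \in Deg f]/(hcomp d f != 0) => fd.
have /hasP[mon fm /eqP <-] : has (fun mon => mdeg mon == d) (msupp f); last exact: fD.
apply: contraNT fd => /hasPn H; rewrite /hcomp big1_seq // => mon /andP[md fm].
by have := H _ fm; rewrite md.
Qed.

End Polynomials.

(** * The lower bound and its attainment *)

Section Optimum.
Variables (p e m k : nat) (F : finFieldType) (D : pred nat).
Hypotheses (p_pr : prime p) (e0 : 0 < e) (m0 : 0 < m) (k0 : 0 < k).
Local Notation q := (p ^ e).
Local Notation Q := (q ^ m).
Hypothesis cardF : #|F| = Q.
Hypothesis DQ : forall d, D d -> d <= k * (Q - 1).
Variable r0 : {ffun 'I_k -> 'I_Q} -> nat.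
Hypothesis feas0 : feasible q Q k D r0.
Local Notation cost r := (\sum_(t | inTD (Q := Q) D t) digsum p (r t)).
Hypothesis min0 : forall r, feasible q Q k D r -> cost r0 <= cost r.

Let p1 : 1 < p := prime_gt1 p_pr.
Let q1 : 1 < q. Proof. by rewrite -(expn0 p) ltn_exp2l. Qed.
Let charFp : p \in [pchar F]%R.
Proof. by apply: (card_finPcharP (n := e * m)); rewrite // cardF expnM. Qed.

Let mu := cost r0 %/ (p - 1).

(** The minimum is an integer: digit sums are congruent to their arguments modulo p - 1, and p - 1
    divides q - 1, which divides the sum of the weights. *)
Lemma cost_min : cost r0 = mu * (p - 1).
Proof.
rewrite /mu divnK // /dvdn.
rewrite (modn_sum_eq _ (fun t _ => digsum_mod p1 (r0 t))).
by case: feas0 => _ dv _; apply: dvdn_trans dv; apply: dvdn_exp_pred; apply: ltnW.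
Qed.

(** Provides the degree d of the monomial x_i^d filling a vanishing coordinate. The column sums of
    [r0] are positive, so some t in T_D has a positive entry. *)
Lemma degree_pos : exists2 d, 0 < d & D d.
Proof.
have [_ _ /(_ (Ordinal k0)) [pos _]] := feas0.
have [/forall_inP H|] := boolP [forall (t | inTD (Q := Q) D t), (t (Ordinal k0) : nat) == 0].
  by move: pos; rewrite big1 // => t /H /eqP ->; rewrite muln0.
case/forall_inPn => t tD t0; exists (\sum_(i < k) (t i : nat)) => //.
by rewrite (bigD1 (Ordinal k0)) //= addn_gt0 lt0n t0.
Qed.

(** Large enough that the two valuations to be read off, [mu * (p - 1)] and that of #|F|,
    [e * m * (p - 1)], lie strictly below L. *)
Let M := mu + e * m + 1.
Let L := M * (p - 1).
Variable O : teichmuller_ring p L F.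

Let p10 : 0 < p - 1. Proof. by rewrite subn_gt0. Qed.
Let EL : e * m * (p - 1) < L. Proof. by rewrite ltn_mul2r p10 /M; lia. Qed.
Let muL : mu * (p - 1) < L. Proof. by rewrite ltn_mul2r p10 /M; lia. Qed.

(** The lower bound for the coefficient, digit sums plus the cost of vanishing columns, is the upper
    bound for the cost of the solution built by [feasible_of_weights]; minimality compares the
    two. *)
Lemma val_ge_term (c : nat -> O) (S : finType) (T : S -> 'I_k -> nat) (r : {ffun S -> 'I_#|F|}) :
    (forall r, r < #|F| -> val_eq (c r) (digsum p r)) -> (forall s, D (\sum_i T s i)) ->
  val_ge (count_coef e c T r) (mu * (p - 1)).
Proof.
move=> cv DT; have [d d0 Dd] := degree_pos.
apply: (val_ge_count_coef charFp cardF cv) => rq nQ.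
have cQ : #|F| - 1 = Q - 1 by rewrite cardF.
have nQ' i : Q - 1 %| \sum_s r s * T s i by rewrite -cQ.
have [r' [fr' le]] := feasible_of_weights p_pr e0 m0 DQ d0 Dd DT rq nQ'.
by rewrite -cost_min (leq_trans (min0 fr')).
Qed.

Lemma val_eq_Ncount n : n <> 0 -> val_eq (n%:R%R : O) (logn p n * (p - 1)).
Proof.
move=> n0; have [|n' pn' Dn] := @pfactor_coprime p n p_pr; first by lia.
rewrite {1}Dn mulnC; apply: val_eq_natr => //.
by rewrite -prime_coprime.
Qed.

Lemma mu_le_logn n : n <> 0 -> val_ge (n%:R%R : O) (mu * (p - 1)) -> mu <= logn p n.
Proof.
move=> n0 vn; rewrite leqNgt; apply/negP => lt.
have ltL : logn p n * (p - 1) < L by apply: leq_ltn_trans muL; rewrite leq_mul2r ltnW ?orbT.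
by have := val_eq_ge ltL (val_eq_Ncount n0) vn; rewrite (leq_pmul2r p10) leqNgt lt.
Qed.

Lemma logn_eq_mu n : val_eq (n%:R%R : O) (mu * (p - 1)) -> n <> 0 /\ logn p n = mu.
Proof.
move=> vn; have n0 : n <> 0.
  move=> n0; case: vn => u ru; rewrite n0 => /esym /(unif_ann ru).
  by rewrite leqNgt muL.
split=> //; apply/eqP; rewrite eqn_leq (mu_le_logn n0 (val_geW vn)) andbT.
by rewrite -(leq_pmul2r p10) (val_eq_ge muL vn (val_geW (val_eq_Ncount n0))).
Qed.

Lemma Ncount_lower (f : {mpoly F[k]}) : {subset Deg f <= D} ->
  Ncount q f <> 0 -> mu <= logn p (Ncount q f).
Proof.
move=> fD N0; apply: mu_le_logn => //.
have [c [cv count]] := point_count O charFp cardF e0 m0 EL.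
pose mon (s : 'I_(size (msupp f))) : 'X_{1..k} := nth 0%MM (msupp f) s.
rewrite (count _ _ (fun s i => mon s i) (fun s => f@_(mon s))%R) => [|x]; last first.
  by rewrite mevalE (big_nth 0%MM) big_mkord.
apply: val_ge_sum => r _.
have [|y ->] := @val_ge_term c _ (fun s i => mon s i) r cv.
  by move=> s; rewrite -mdegE; apply/fD/Deg_msupp/mem_nth.
by eexists; rewrite -mulrA.
Qed.

Lemma Ncount_attained : exists f : {mpoly F[k]}, {subset Deg f <= D} /\
  (Ncount q f <> 0 /\ logn p (Ncount q f) = mu).
Proof.
have [c [cv count]] := point_count O charFp cardF e0 m0 EL.
pose S := {t : {ffun 'I_k -> 'I_Q} | inTD D t}.
pose T (s : S) (i : 'I_k) : nat := val s i.
pose mon (s : S) : 'X_{1..k} := [multinom T s i | i < k].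
have DT s : D (\sum_i T s i) by exact: (valP s).
have cT : forall r : {ffun S -> 'I_#|F|}, exists y,
    count_coef e c T r = (unif O ^+ (mu * (p - 1)) * y)%R by move=> r; apply: val_ge_term.
have [y yE] := @fin_all_exists _ (fun=> O : Type) _ cT.
have r0lt (s : S) : r0 (val s) < #|F|.
  have [le _ _] := feas0; rewrite cardF; apply: leq_ltn_trans (le _ (valP s)) _.
  by rewrite ltn_subLR ?add1n ?ltnS // expn_gt0 expn_gt0 ltnW.
pose r : {ffun S -> 'I_#|F|} := [ffun s => Ordinal (r0lt s)].
have rE s : r s = r0 (val s) :> nat by rewrite ffunE.
have sumS (g : {ffun 'I_k -> 'I_Q} -> nat) :
    \sum_(s : S) g (val s) = \sum_(t | inTD D t) g t by rewrite -big_sub.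
have vr : val_eq (count_coef e c T r) (mu * (p - 1)).
  have [_ dq feasi] := feas0; have cQ : #|F| - 1 = Q - 1 by rewrite cardF.
  have sum_r : \sum_s r s = \sum_(t | inTD (Q := Q) D t) r0 t.
    by rewrite -sumS; apply: eq_bigr => s _; rewrite rE.
  have sum_rT i : \sum_s r s * T s i = \sum_(t | inTD (Q := Q) D t) r0 t * t i.
    by rewrite -(sumS (fun t => r0 t * t i)); apply: eq_bigr => s _; rewrite rE.
  rewrite -cost_min -(sumS (fun t => digsum p (r0 t))).
  have <- : \sum_s digsum p (r s) = \sum_(s : S) digsum p (r0 (val s)).
    by apply: eq_bigr => s _; rewrite rE.
  apply: (val_count_coef charFp cardF e0 m0 cv); rewrite ?sum_r //; last first.
    by move=> i; rewrite sum_rT cQ.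
  have [pos _] := feasi (Ordinal k0); move: pos; rewrite !lt0n; apply: contraNN.
  rewrite !sum_nat_eq0 => /forall_inP H; apply/forall_inP => t tD.
  by rewrite (eqP (H t tD)) mul0n.
(* The cofactors [y] were only chosen to exist; at the optimal [r] the exact valuation of the
   coefficient forces a nonzero residue. *)
have yr : residue O (y r) != 0%R.
  apply/eqP => /residue_eq0 [z Dz].
  have /(val_eq_ge muL vr) : val_ge (count_coef e c T r) (mu * (p - 1)).+1.
    by exists z; rewrite yE Dz exprSr mulrA.
  by rewrite ltnn.
have E0 : 0 < e * m by rewrite muln_gt0 e0.
have cardFE : #|F| = p ^ (e * m) by rewrite expnM.
have [a a0] := @reduced_poly_neq0 p (e * m) L F O charFp cardFE E0 S (fun u => residue O (y u)) r yr.
pose f : {mpoly F[k]} := (\sum_s a s *: 'X_[mon s])%R.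
have fE (x : 'I_k -> F) : (f.@[x] = \sum_s a s * \prod_(i < k) x i ^+ T s i)%R.
  rewrite raddf_sum; apply: eq_bigr => s _; rewrite /= mevalZ mevalX; congr (_ * _)%R.
  by apply: eq_bigr => i _; rewrite mnmE.
exists f; split.
  apply: sub_Deg => u; rewrite mcoeff_msupp => fu.
  have [s /eqP <-] : exists s, mon s == u.
    apply/existsP; apply: contraR fu => /existsPn ne.
    rewrite raddf_sum big1 // => s _.
    by rewrite /= mcoeffZ mcoeffX (negPf (ne s)) mulr0.
  by rewrite mdegE (eq_bigr (T s)) // => i _; rewrite mnmE.
apply: logn_eq_mu; rewrite (count _ _ T a f fE).
(* Since tau(a_s) has residue a_s, the residue of this cofactor is the reduced polynomial evaluated
   at [a]. *)
exists (\sum_r y r * \prod_s teich O (a s) ^+ r s)%R.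
  move=> E; move/eqP: a0; apply; rewrite -[RHS]E rmorph_sum; apply: eq_bigr => u _.
  rewrite rmorphM rmorph_prod; congr (_ * _)%R; apply: eq_bigr => s _.
  by rewrite rmorphXn teichK.
by rewrite mulr_sumr; apply: eq_bigr => u _; rewrite yE mulrA.
Qed.

End Optimum.

Unset Implicit Arguments.
Set Strict Implicit.

Theorem theorem5p1 (p e m k : nat) (F : finFieldType) (D : pred nat) (mu : rat) :
  prime p -> 0 < e -> 0 < m -> 0 < k ->
  #|F| = (p ^ e) ^ m ->
  (forall d, D d -> d <= k * ((p ^ e) ^ m - 1)) ->
  ~ (D =i pred1 0) ->
  is_min_value p (p ^ e) ((p ^ e) ^ m) k D mu ->
  (forall f : {mpoly F[k]}, {subset Deg f <= D} ->
     Ncount (p ^ e) f = 0 \/ (mu <= (logn p (Ncount (p ^ e) f))%:R)%R) /\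
  (exists f : {mpoly F[k]}, {subset Deg f <= D} /\
     Ncount (p ^ e) f <> 0 /\ ((logn p (Ncount (p ^ e) f))%:R = mu :> rat)%R).
Proof.
move=> p_pr e0 m0 k0 cardF DQ _ [[r0 [feas0 muE]] min_mu].
have p10 : 0 < p - 1 by rewrite subn_gt0 prime_gt1.
have p10R : (0 < (p - 1)%:R :> rat)%R by rewrite ltr0n.
have min0 r : feasible (p ^ e) ((p ^ e) ^ m) k D r ->
    \sum_(t | inTD D t) digsum p (r0 t) <= \sum_(t | inTD D t) digsum p (r t).
  by move/min_mu; rewrite -muE /objective ler_pM2r ?invr_gt0 // ler_nat.
set v := (\sum_(t | inTD (Q := (p ^ e) ^ m) D t) digsum p (r0 t)) %/ (p - 1).
have Dmu : mu = v%:R%R.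
  rewrite -muE /objective (cost_min p_pr feas0) -/v natrM mulfK //.
  by rewrite gt_eqF.
have charFp : p \in [pchar F]%R.
  by apply: (card_finPcharP (n := e * m)); rewrite // cardF expnM.
have E0 : 0 < e * m by rewrite muln_gt0 e0.
have cardFE : #|F| = p ^ (e * m) by rewrite cardF expnM.
(* The truncation level depends on the minimum, so the ring is chosen only here. *)
have [O] : inhabited (teichmuller_ring p ((v + e * m + 1) * (p - 1)) F).
  by apply: (teichmuller_ring_exists charFp E0 cardFE); rewrite addn1.
split=> [f fD|].
  have [->|/eqP N0] := eqVneq (Ncount (p ^ e) f) 0; [by left|right].
  by rewrite Dmu ler_nat (Ncount_lower p_pr e0 m0 k0 cardF DQ feas0 min0 O fD N0).
have [f [fD [N0 Nv]]] := Ncount_attained p_pr e0 m0 k0 cardF DQ feas0 min0 O.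
by exists f; rewrite Nv Dmu.
Qed.
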